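(* Let $\Omega\subset\mathbb{R}^N$ be a bounded open connected set and $h\in C(\Omega)$ with $h\ge0$ on $\Omega$. Then the map $\Theta(x):=\{(r,A)\in\mathcal{Q}:(-r)^{N+2}\det A\ge h(x)\}$ is a Hausdorff continuous proper elliptic map and $\partial\Theta(x)\subset\{(r,A)\in\mathbb{R}\times\mathcal{S}(N):(-r)^{N+2}\det A=h(x)\}$ for all $x\in\Omega$. Moreover, if $u\in\mathrm{USC}(\overline\Omega)$ restricts to a $\mathcal{Q}$-admissible viscosity subsolution and $v\in\mathrm{LSC}(\overline\Omega)$ restricts to a $\mathcal{Q}$-admissible viscosity supersolution of $[-u(x)]^{N+2}\det D^2u(x)=h(x)$ in $\Omega$, then $u\le v$ on $\partial\Omega$ implies $u\le v$ in $\Omega$.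
   Context: $\mathcal{S}(N)$: real symmetric $N\times N$ matrices with usual partial order, eigenvalues $\lambda_i(A)$. $\mathcal{Q}:=\{(s,P)\in\mathbb{R}\times\mathcal{S}(N): s\le0,\ P\ge0\}$. A proper elliptic map assigns to each $x\in\Omega$ a closed, nonempty set $\subsetneq\mathbb{R}\times\mathcal{S}(N)$ invariant under adding elements of $\mathcal Q$. Hausdorff continuity: with norm $\|(r,A)\|=\max\{|r|,\max_i|\lambda_i(A)|\}$ and the Hausdorff distance $d_{\mathcal H}$ (possibly $+\infty$), for all $x\in\Omega,\eta>0$ there is $\delta>0$ with $d_{\mathcal H}(\Theta(x),\Theta(y))<\eta$ for $y\in\Omega$, $|x-y|<\delta$. Let $F(x,r,A):=(-r)^{N+2}\det A-h(x)$. $J^+_{x_0}u:=\{(\varphi(x_0),D^2\varphi(x_0)):\varphi$ is $C^2$ near $x_0$, $u\le\varphi$ near $x_0$, $u(x_0)=\varphi(x_0)\}$, $J^-_{x_0}u$ likewise with $u\ge\varphi$. $u\in\mathrm{USC}(\Omega)$ is a $\mathcal Q$-admissible viscosity subsolution if for all $x_0\in\Omega$, $(r,A)\in J^+_{x_0}u$: $F(x_0,r,A)\ge0$ and $(r,A)\in\mathcal Q$. $v\in\mathrm{LSC}(\Omega)$ is a $\mathcal Q$-admissible viscosity supersolution if for all $x_0$, $(r,A)\in J^-_{x_0}v$: $F(x_0,r,A)\le0$ or $(r,A)\notin\mathcal Q^\circ$. *)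

(* Defs.v *)
From HB Require Import structures.
From mathcomp Require Import all_boot all_order all_algebra.
From mathcomp Require Import all_classical all_reals all_analysis.
Set Implicit Arguments. Unset Strict Implicit. Unset Printing Implicit Defensive.
Import Order.TTheory GRing.Theory Num.Theory.
Import numFieldNormedType.Exports.
Local Open Scope classical_set_scope.
Local Open Scope ring_scope.

Section Defs.
Variables (R : realType) (N : nat).

Notation pt := 'rV[R]_N.
Notation pair := (R * 'M[R]_N)%type.

Definition symmetric_mx (A : 'M[R]_N) : Prop := A^T = A.
Definition SymPairs : set pair := [set p | symmetric_mx p.2].

Definition psd (P : 'M[R]_N) : Prop := forall x : 'rV[R]_N, 0 <= (x *m P *m x^T) 0 0.

Definition Qset : set pair := [set p | symmetric_mx p.2 /\ p.1 <= 0 /\ psd p.2].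

Definition spec_norm (A : 'M[R]_N) : R := sup [set `|a| | a in [set a | eigenvalue A a]].

Definition pdist (p q : pair) : R := Num.max `|p.1 - q.1| (spec_norm (p.2 - q.2)).

Definition rinterior (S : set pair) : set pair :=
  [set p | SymPairs p /\ exists2 e : R, 0 < e &
     forall q, SymPairs q -> pdist p q < e -> S q].
Definition rclosure (S : set pair) : set pair :=
  [set p | SymPairs p /\ forall e : R, 0 < e -> exists2 q, S q & pdist p q < e].
Definition rclosed (S : set pair) : Prop := rclosure S `<=` S.
Definition rboundary (S : set pair) : set pair := rclosure S `\` rinterior S.

Definition padd (p q : pair) : pair := (p.1 + q.1, p.2 + q.2).

Definition proper_elliptic (Omega : set pt) (Theta : pt -> set pair) : Prop :=
  forall x, Omega x ->
    [/\ Theta x `<=` SymPairs, rclosed (Theta x), Theta x !=set0,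
        Theta x != SymPairs &
        forall p q, Theta x p -> Qset q -> Theta x (padd p q)].

Definition dist_to (p : pair) (S : set pair) : \bar R :=
  ereal_inf [set (pdist p q)%:E | q in S].
Definition hausdorff_dist (S T : set pair) : \bar R :=
  maxe (ereal_sup [set dist_to p T | p in S]) (ereal_sup [set dist_to q S | q in T]).

Definition hausdorff_continuous (Omega : set pt) (Theta : pt -> set pair) : Prop :=
  forall x, Omega x -> forall eta : R, 0 < eta ->
    exists2 delta : R, 0 < delta &
      forall y, Omega y -> `|x - y| < delta ->
        (hausdorff_dist (Theta x) (Theta y) < eta%:E)%E.

Definition Fop (h : pt -> R) (x : pt) (r : R) (A : 'M[R]_N) : R :=
  (- r) ^+ (N + 2) * \det A - h x.

Definition usc_on (D : set pt) (u : pt -> R) : Prop :=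
  forall x, D x -> forall e : R, 0 < e -> exists2 d : R, 0 < d &
    forall y, D y -> `|y - x| < d -> u y < u x + e.
Definition lsc_on (D : set pt) (u : pt -> R) : Prop :=
  forall x, D x -> forall e : R, 0 < e -> exists2 d : R, 0 < d &
    forall y, D y -> `|y - x| < d -> u x - e < u y.

Definition ebasis (i : 'I_N) : pt := delta_mx 0 i.
Definition partial (f : pt -> R) (i : 'I_N) : pt -> R := fun y => derive f y (ebasis i).
Definition hessian (f : pt -> R) (x : pt) : 'M[R]_N :=
  \matrix_(i, j) partial (partial f j) i x.

Definition C2_near (phi : pt -> R) (x0 : pt) : Prop :=
  exists2 r : R, 0 < r & forall x, ball x0 r x ->
    [/\ {for x, continuous phi},
        forall i, derivable phi x (ebasis i) /\ {for x, continuous (partial phi i)},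
        forall i j, derivable (partial phi j) x (ebasis i) &
        forall i j, {for x, continuous (partial (partial phi j) i)}].

Definition jet_plus (Omega : set pt) (u : pt -> R) (x0 : pt) : set pair :=
  [set p | exists phi, [/\ C2_near phi x0,
     (exists2 r : R, 0 < r & forall y, Omega y -> ball x0 r y -> u y <= phi y),
     u x0 = phi x0 & p = (phi x0, hessian phi x0)]].
Definition jet_minus (Omega : set pt) (u : pt -> R) (x0 : pt) : set pair :=
  [set p | exists phi, [/\ C2_near phi x0,
     (exists2 r : R, 0 < r & forall y, Omega y -> ball x0 r y -> phi y <= u y),
     u x0 = phi x0 & p = (phi x0, hessian phi x0)]].

Definition Q_subsolution (Omega : set pt) (h : pt -> R) (u : pt -> R) : Prop :=
  forall x0, Omega x0 -> forall p, jet_plus Omega u x0 p ->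
    0 <= Fop h x0 p.1 p.2 /\ Qset p.
Definition Q_supersolution (Omega : set pt) (h : pt -> R) (v : pt -> R) : Prop :=
  forall x0, Omega x0 -> forall p, jet_minus Omega v x0 p ->
    Fop h x0 p.1 p.2 <= 0 \/ ~ rinterior Qset p.

Definition ThetaMA (h : pt -> R) (x : pt) : set pair :=
  [set p | Qset p /\ h x <= (- p.1) ^+ (N + 2) * \det p.2].

End Defs.

(* Main.v *)
Require Import Defs.
From HB Require Import structures.
From mathcomp Require Import all_boot all_order all_algebra.
From mathcomp Require Import all_classical all_reals all_analysis.
From mathcomp Require Import ring lra.
Import Order.TTheory GRing.Theory Num.Theory.
Import numFieldNormedType.Exports.
Local Open Scope classical_set_scope.
Local Open Scope ring_scope.

(** The elliptic map is handled by shifting: [(r, A)] is replaced by [(r - t, A + t I)], and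
    superadditivity of the determinant on positive semidefinite matrices gives a gain of
    [t^(2 N + 2)] in [(-r)^(N+2) det A].

    For the comparison principle no theorem on sums is needed, because the operator is concave.
    A subsolution [u] is nonpositive and locally convex, hence locally Lipschitz, and
    [det D^2 u >= q] in the viscosity sense is equivalent to a family of linear inequalities
    [tr (S D^2 u S^T) >= c] with constant [S].  Each of them survives averaging over translations,
    so a [C^2] average [f] of [u], uniformly close to [u], satisfies [det D^2 f >= q] classically,
    and [f], slightly perturbed, is an admissible test function for the supersolution [v] at a
    maximum point of [f - v].

    That averages preserve a linear inequality is shown with the resolvent of
    [L := tr (S D^2 . S^T)].  Since plane waves are eigenfunctions of [L], the equation
    [w - k^2 L w = p] is solved explicitly for trigonometric polynomials [p], and Bernstein
    polynomials in shifted cosines yield a partition of unity by such [p] around a point [y].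
    The maximum principle, applied to a viscosity subsolution of [L g >= c] and to a [C^2] function
    of the form [w + barrier], gives [g y <= sum_i om_i g(y_i) - k^2 c + O(k^4)] with nodes [y_i]
    and weights [om_i] that do not depend on [g].  This inequality can be averaged over translates
    of [u], and comparing it with the one for [-f] as [k] tends to [0] gives [L f >= c]. *)

Set Implicit Arguments. Unset Strict Implicit. Unset Printing Implicit Defensive.

(** * Continuous functions and closed balls *)

Section ContinuousFunctions.
Variables (R : realType) (T : topologicalType).

Lemma continuous_sum (I : Type) (r : seq I) (F : I -> T -> R) :
  (forall i, continuous (F i)) -> continuous (fun t => \sum_(i <- r) F i t).
Proof. by move=> cF; apply: continuous_big => [|i _]; [exact: add_continuous|exact: cF]. Qed.

Lemma continuous_cstM (c : R) (g : T -> R) :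
  continuous g -> continuous (fun t : T => c * g t).
Proof. by move=> cg t; apply: continuousM; [exact: cst_continuous|exact: cg]. Qed.

Lemma within_open_continuous_at (g : T -> R) (D : set T) (x : T) : open D ->
  {within D, continuous g} -> D x -> {for x, continuous g}.
Proof. by move=> oD + Dx; rewrite continuous_open_subspace// => /(_ x); rewrite inE; exact. Qed.

End ContinuousFunctions.

Section ClosedBalls.
Variables (R : realType) (V : normedModType R).
Implicit Types (x y z : V) (r : R).

Lemma continuous_shift (g : V -> R) z :
  continuous g -> continuous (fun x : V => g (x + z)).
Proof.
move=> cg x; apply: (@continuous_comp _ _ _ (fun x : V => x + z) g); last exact: cg.
by apply: continuousD; [exact: id|exact: cst_continuous].
Qed.

Lemma closed_ballP x y r : 0 < r ->
  closed_ball x r y <-> `|y - x| <= r.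
Proof. by move=> r0; rewrite closed_ballE// distrC. Qed.

Lemma near_closed_ball y x r : `|x - y| < r -> \forall z \near x, closed_ball y r z.
Proof.
move=> xy; have : ball y r x by rewrite -ball_normE /= distrC.
move=> bx; have := open_nbhs_nbhs (conj (@ball_open _ _ y r) bx).
by apply: filterS; exact: subset_closed_ball.
Qed.

End ClosedBalls.

(** * Symmetric matrices *)

Definition dotp (R : comNzRingType) (n : nat) (x y : 'rV[R]_n) : R := (x *m y^T) 0 0.

Definition qform (R : comNzRingType) (n : nat) (A : 'M[R]_n) (x : 'rV[R]_n) : R :=
  dotp (x *m A) x.

Section DotProduct.
Variables (R : comNzRingType) (n : nat).
Implicit Types (x y z : 'rV[R]_n) (A B : 'M[R]_n) (c : R).

Lemma dotpE x y : dotp x y = \sum_i x 0 i * y 0 i.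
Proof. by rewrite /dotp mxE; apply: eq_bigr => i _; rewrite mxE. Qed.

Lemma mulmx_tr_dotp x y : x *m y^T = (dotp x y)%:M.
Proof. exact: mx11_scalar. Qed.

Lemma dotpC x y : dotp x y = dotp y x.
Proof. by rewrite !dotpE; apply: eq_bigr => i _; rewrite mulrC. Qed.

Lemma dotpDl x y z : dotp (x + y) z = dotp x z + dotp y z.
Proof. by rewrite /dotp mulmxDl mxE. Qed.

Lemma dotpZl c x y : dotp (c *: x) y = c * dotp x y.
Proof. by rewrite /dotp -scalemxAl mxE. Qed.

Lemma dotpDr x y z : dotp x (y + z) = dotp x y + dotp x z.
Proof. by rewrite dotpC dotpDl !(dotpC x). Qed.

Lemma dotpZr c x y : dotp x (c *: y) = c * dotp x y.
Proof. by rewrite dotpC dotpZl dotpC. Qed.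

Lemma dotpBl x y z : dotp (x - y) z = dotp x z - dotp y z.
Proof. by rewrite -scaleN1r dotpDl dotpZl mulN1r. Qed.

Lemma dotpBr x y z : dotp x (y - z) = dotp x y - dotp x z.
Proof. by rewrite dotpC dotpBl !(dotpC x). Qed.

Lemma dotp0l x : dotp 0 x = 0.
Proof. by rewrite /dotp mul0mx mxE. Qed.

Lemma dotp_delta x i : dotp x (delta_mx 0 i) = x 0 i.
Proof. by rewrite /dotp trmx_delta -colE mxE. Qed.

Lemma dotp_mulmx m x (A : 'M[R]_(n, m)) (y : 'rV[R]_m) : dotp (x *m A) y = dotp x (y *m A^T).
Proof. by rewrite /dotp trmx_mul trmxK mulmxA. Qed.

Lemma qformD A B x : qform (A + B) x = qform A x + qform B x.
Proof. by rewrite /qform mulmxDr dotpDl. Qed.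

Lemma qformZ c A x : qform (c *: A) x = c * qform A x.
Proof. by rewrite /qform -scalemxAr dotpZl. Qed.

Lemma qform_scalar c x : qform c%:M x = c * dotp x x.
Proof. by rewrite /qform mul_mx_scalar dotpZl. Qed.

Lemma qform_congr m (S : 'M[R]_(m, n)) A (x : 'rV[R]_m) :
  qform (S *m A *m S^T) x = qform A (x *m S).
Proof. by rewrite /qform !mulmxA dotp_mulmx trmxK. Qed.

Lemma qform_outer x y : qform (y^T *m y) x = dotp x y ^+ 2.
Proof.
by rewrite /qform mulmxA mulmx_tr_dotp mul_scalar_mx dotpZl (dotpC y) expr2.
Qed.

Lemma qform_delta A i : qform A (delta_mx 0 i) = A i i.
Proof. by rewrite /qform dotp_delta -rowE mxE. Qed.

End DotProduct.

Section RowVectorNorm.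
Variables (R : realType) (n : nat).
Implicit Types (x : 'rV[R]_n) (A : 'M[R]_n).

Lemma coord_le_norm x i : `|x 0 i| <= `|x|.
Proof.
by rewrite (_ : `|x| = mx_norm x)// mx_normrE; apply/bigmax_geP; right; exists (0, i).
Qed.

Lemma rV_norm_le x (M : R) : 0 <= M -> (forall i, `|x 0 i| <= M) -> `|x| <= M.
Proof.
move=> M0 xM; rewrite (_ : `|x| = mx_norm x)// mx_normrE; apply/bigmax_leP.
by split=> // -[i j] _ /=; rewrite (ord1 i).
Qed.

Lemma rV_norm_lt x (M : R) : 0 < M -> (forall i, `|x 0 i| < M) -> `|x| < M.
Proof.
move=> M0 xM; rewrite (_ : `|x| = mx_norm x)// mx_normrE; apply/bigmax_ltP.
by split=> // -[i j] _ /=; rewrite (ord1 i).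
Qed.

Lemma compact_closed_ball x (r : R) : 0 < r -> compact (closed_ball x r).
Proof.
move=> r0; apply: bounded_closed_compact; last exact: closed_ball_closed.
exists (r + `|x|); split=> [|M rM y /(closed_ballP _ _ r0) yx]; first exact: num_real.
by apply: le_trans (ltW rM); rewrite -[y](subrK x) (le_trans (ler_normD _ _))// lerD2r.
Qed.

Lemma compact_closure_bounded (D : set 'rV[R]_n) : bounded_set D -> compact (closure D).
Proof.
move=> [M [_ DM]]; have M0 : 0 < `|M| + 2 by rewrite ltr_wpDl.
apply: subclosed_compact (@compact_closed_ball 0 _ M0) _; first exact: closed_closure.
apply: closureS => x Dx; rewrite -ball_normE/= sub0r normrN.
have /DM/(_ _ Dx)/le_lt_trans : M < `|M| + 1 by rewrite (le_lt_trans (ler_norm M))// ltrDl.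
by apply; rewrite ltrD2l ltr1n.
Qed.

Lemma dotpp_ge0 x : 0 <= dotp x x.
Proof. by rewrite dotpE; apply: sumr_ge0 => i _; rewrite -expr2 sqr_ge0. Qed.

Lemma sqr_coord_le_dotpp x i : x 0 i ^+ 2 <= dotp x x.
Proof.
rewrite dotpE (bigD1 i)//= -expr2 lerDl.
by apply: sumr_ge0 => j _; rewrite -expr2 sqr_ge0.
Qed.

Lemma sqr_norm_le_dotpp x : `|x| ^+ 2 <= dotp x x.
Proof.
rewrite -[leRHS]sqr_sqrtr ?dotpp_ge0// ler_pXn2r ?nnegrE ?sqrtr_ge0//.
apply: rV_norm_le => [|i]; first exact: sqrtr_ge0.
by rewrite -sqrtr_sqr ler_wsqrtr// sqr_coord_le_dotpp.
Qed.

Lemma dotpp_eq0 x : (dotp x x == 0) = (x == 0).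
Proof.
apply/eqP/eqP => [xx0|->]; last exact: dotp0l.
apply/rowP => i; rewrite [RHS]mxE; apply/eqP.
by rewrite -sqrf_eq0 eq_le sqr_ge0 andbT -xx0 sqr_coord_le_dotpp.
Qed.

Lemma dotpp_gt0 x : (0 < dotp x x) = (x != 0).
Proof. by rewrite lt_neqAle dotpp_ge0 andbT eq_sym dotpp_eq0. Qed.

Lemma continuous_dotpr (y : 'rV[R]_n) : continuous (fun x : 'rV[R]_n => dotp x y).
Proof.
under eq_fun do (rewrite dotpE; under eq_bigr do rewrite mulrC).
by apply: continuous_sum => i; apply: continuous_cstM; exact: coord_continuous.
Qed.

Lemma continuous_qform A : continuous (qform A).
Proof.
rewrite (_ : qform A = fun x : 'rV[R]_n => \sum_i dotp x (row i A^T) * x 0 i).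
  apply: continuous_sum => i x.
  exact: (continuousM (@continuous_dotpr (row i A^T) x) (@coord_continuous _ _ _ 0 i x)).
apply/funext => x; rewrite /qform dotpE; apply: eq_bigr => i _; congr (_ * _).
by rewrite dotpE mxE; apply: eq_bigr => j _; rewrite !mxE.
Qed.

Lemma continuous_dotpp : continuous (fun x : 'rV[R]_n => dotp x x).
Proof.
rewrite (_ : (fun _ => _) = qform 1%:M); first exact: continuous_qform.
by apply/funext => x; rewrite qform_scalar mul1r.
Qed.

Lemma compact_unit_sphere : compact [set x : 'rV[R]_n | dotp x x = 1].
Proof.
apply: bounded_closed_compact.
  exists 1; split=> [|M M1 x /= xx1]; first exact: num_real.
  apply: le_trans (ltW M1).
  by rewrite -(@ler_pXn2r _ 2)// ?nnegrE// expr1n (le_trans (sqr_norm_le_dotpp _))// xx1.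
rewrite (_ : mkset _ = (fun x => dotp x x) @^-1` [set 1])//.
by apply: preimage_closed => [x _|]; [exact: continuous_dotpp|exact: closed_eq].
Qed.

End RowVectorNorm.

Section SymmetricMatrices.
Variable R : realType.

Lemma symmx_scalar n (c : R) : symmetric_mx (c%:M : 'M[R]_n).
Proof. exact: tr_scalar_mx. Qed.

Lemma symmxD n (A B : 'M[R]_n) : symmetric_mx A -> symmetric_mx B -> symmetric_mx (A + B).
Proof. by move=> sA sB; rewrite /symmetric_mx linearD/= sA sB. Qed.

Lemma symmxB n (A B : 'M[R]_n) : symmetric_mx A -> symmetric_mx B -> symmetric_mx (A - B).
Proof. by move=> sA sB; rewrite /symmetric_mx linearB/= sA sB. Qed.

Lemma symmx_congr m n (A : 'M[R]_n) (S : 'M[R]_(m, n)) :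
  symmetric_mx A -> symmetric_mx (S *m A *m S^T).
Proof. by move=> sA; rewrite /symmetric_mx !trmx_mul trmxK sA mulmxA. Qed.

Lemma psdP n (A : 'M[R]_n) : psd A <-> forall x, 0 <= qform A x.
Proof. by []. Qed.

Lemma psdD n (A B : 'M[R]_n) : psd A -> psd B -> psd (A + B).
Proof. by move=> pA pB; apply/psdP => x; rewrite qformD addr_ge0//; [exact: pA|exact: pB]. Qed.

Lemma psd_scalar n (c : R) : 0 <= c -> psd (c%:M : 'M[R]_n).
Proof. by move=> c0; apply/psdP => x; rewrite qform_scalar mulr_ge0// dotpp_ge0. Qed.

Lemma psd_congr m n (A : 'M[R]_n) (S : 'M[R]_(m, n)) : psd A -> psd (S *m A *m S^T).
Proof. by move=> pA; apply/psdP => x; rewrite qform_congr; exact: pA. Qed.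

Lemma psd_trace_ge0 n (A : 'M[R]_n) : psd A -> 0 <= \tr A.
Proof. by move=> pA; apply: sumr_ge0 => i _; rewrite -qform_delta; exact: pA. Qed.

Lemma psd_of_addscalar n (A : 'M[R]_n) : (forall e, 0 < e -> psd (A + e%:M)) -> psd A.
Proof.
move=> pAe; apply/psdP => x; apply/ler_addgt0Pl => e e0.
have xx1 : 0 < dotp x x + 1 by rewrite ltr_wpDl ?dotpp_ge0.
have /psdP/(_ x) := pAe _ (divr_gt0 e0 xx1); rewrite qformD qform_scalar => /le_trans; apply.
by rewrite addrC lerD2r mulrAC ler_pdivrMr// ler_pM2l// lerDl.
Qed.

Lemma symmx_bilinC n (A : 'M[R]_n) (x y : 'rV[R]_n) :
  symmetric_mx A -> dotp (x *m A) y = dotp (y *m A) x.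
Proof. by move=> sA; rewrite dotp_mulmx sA dotpC. Qed.

Lemma qform_line n (A : 'M[R]_n) (x y : 'rV[R]_n) (t : R) : symmetric_mx A ->
  qform A (x + t *: y) = qform A x + 2 * t * dotp (x *m A) y + t ^+ 2 * qform A y.
Proof.
move=> sA; rewrite /qform mulmxDl -scalemxAl !(dotpDl, dotpDr, dotpZl, dotpZr).
by rewrite (symmx_bilinC y x sA); ring.
Qed.

Lemma psd_kernel n (A : 'M[R]_n) (x : 'rV[R]_n) :
  symmetric_mx A -> psd A -> qform A x = 0 -> x *m A = 0.
Proof.
move=> sA pA x0; apply/eqP; rewrite -dotpp_eq0; set y := x *m A.
have c0 : 0 <= qform A y := pA _.
have line_ge0 t : 0 <= 2 * t * dotp y y + t ^+ 2 * qform A y.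
  by move/psdP/(_ (x + t *: y)) : (pA); rewrite qform_line// x0 add0r.
rewrite eq_le dotpp_ge0 andbT leNgt; apply/negP => yy0.
have c1 : 0 < qform A y + 1 by rewrite ltr_wpDl.
have := line_ge0 (- dotp y y / (qform A y + 1)).
have -> : 2 * (- dotp y y / (qform A y + 1)) * dotp y y +
    (- dotp y y / (qform A y + 1)) ^+ 2 * qform A y =
   - (dotp y y ^+ 2 * (qform A y + 2) / (qform A y + 1) ^+ 2) by field; rewrite gt_eqF.
by rewrite oppr_ge0 leNgt divr_gt0// ?mulr_gt0 ?exprn_gt0// ltr_wpDl.
Qed.

(* The eigenvector is a maximum point of the Rayleigh quotient. *)
Lemma symmx_eigenvector n (A : 'M[R]_n.+1) : symmetric_mx A ->
  exists a (x : 'rV[R]_n.+1), dotp x x = 1 /\ x *m A = a *: x.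
Proof.
move=> sA.
have sphere0 : [set x : 'rV[R]_n.+1 | dotp x x = 1] !=set0.
  by exists (delta_mx 0 0); rewrite /= dotp_delta mxE !eqxx.
have [|x] := EVT_max_rV sphere0 (@compact_unit_sphere R n.+1) (f := qform A).
  by apply: continuous_subspaceT; exact: continuous_qform.
rewrite inE/= => xx1 xmax; exists (qform A x), x; split=> //; set a := qform A x in xmax *.
apply/eqP; rewrite eq_sym -subr_eq0 -mul_mx_scalar -mulmxBr; apply/eqP.
have qaA y : qform (a%:M - A) y = a * dotp y y - qform A y.
  by rewrite -scaleN1r qformD qformZ qform_scalar mulN1r.
apply: psd_kernel; last by rewrite qaA xx1 mulr1 subrr.
  exact: symmxB (symmx_scalar _ _) sA.
apply/psdP => y; rewrite qaA subr_ge0; have [->|y0] := eqVneq y 0.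
  by rewrite /qform mul0mx !dotp0l mulr0.
have yy0 : 0 < dotp y y by rewrite dotpp_gt0.
pose s := Num.sqrt (dotp y y); have s0 : s != 0 by rewrite sqrtr_eq0 -ltNge.
have s2 : s ^+ 2 = dotp y y by rewrite sqr_sqrtr// ltW.
have := xmax (s^-1 *: y); rewrite !inE /= /qform -scalemxAl !(dotpZl, dotpZr) -/(qform A y).
rewrite !mulrA -!expr2 exprVn s2 mulVf ?gt_eqF// => /(_ erefl).
by rewrite mulrC ler_pdivrMr.
Qed.

End SymmetricMatrices.

Definition orthogonal_mx (R : comNzRingType) n (P : 'M[R]_n) : Prop := P *m P^T = 1%:M.

Section Spectral.
Variable R : realType.

(* Householder reflection exchanging [x] and the first basis vector. *)
Lemma reflection_to n (x : 'rV[R]_n.+1) : dotp x x = 1 ->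
  exists Q : 'M[R]_n.+1, [/\ Q^T = Q, Q *m Q = 1%:M & delta_mx 0 0 *m Q = x].
Proof.
move=> xx1; pose e : 'rV[R]_n.+1 := delta_mx 0 0.
have ee1 : dotp e e = 1 by rewrite dotp_delta mxE !eqxx.
have [->|xe] := eqVneq x e; first by exists 1%:M; rewrite trmx1 !mulmx1.
pose w := e - x; pose s : R := dotp w w.
have s0 : s != 0 by rewrite dotpp_eq0 subr_eq0 eq_sym.
have sE : s = 2 * dotp e w by rewrite /s /w !(dotpBl, dotpBr) ee1 xx1 (dotpC x e); ring.
exists (1%:M - (2 / s) *: (w^T *m w)); split.
- by rewrite linearB/= trmx1 linearZ/= trmx_mul trmxK.
- have WW : (w^T *m w) *m (w^T *m w) = s *: (w^T *m w).
    by rewrite -mulmxA (mulmxA w) mulmx_tr_dotp mul_scalar_mx -scalemxAr.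
  move: (w^T *m w) WW => W WW.
  rewrite mulmxBl mul1mx mulmxBr mulmx1 -scalemxAl -scalemxAr WW !scalerA.
  rewrite -[RHS]addr0 -addrA; congr (_ + _); rewrite -opprD addrA -scalerDl -scalerBl.
  by rewrite (_ : _ - _ = 0) ?scale0r ?oppr0//; field.
- rewrite -/e mulmxBr mulmx1 -scalemxAr mulmxA mulmx_tr_dotp mul_scalar_mx scalerA.
  by rewrite mulrAC -sE divff// scale1r /w opprB addrC subrK.
Qed.

Lemma symmx_block_of_row0 n (B : 'M[R]_(1 + n)) a : symmetric_mx B ->
  row 0 B = a *: delta_mx 0 0 -> B = block_mx a%:M 0 0 (drsubmx B).
Proof.
move=> sB B0.
have rowB (i j : 'I_(1 + n)) : i = 0%N :> nat -> B i j = (j == 0%N :> nat)%:R * a.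
  move=> i0; have := congr1 (fun M : 'rV[R]_(1 + n) => M 0 j) B0; rewrite !mxE/= mulrC => <-.
  by congr (B _ j); exact: val_inj.
rewrite -[LHS](@submxK _ 1 n 1 n); congr block_mx.
- by rewrite [LHS]mx11_scalar !mxE rowB// mul1r.
- by apply/rowP => j; rewrite !mxE rowB// mul0r.
- by apply/colP => j; rewrite !mxE -sB mxE rowB// mul0r.
Qed.

Theorem symmx_spectral n (A : 'M[R]_n) : symmetric_mx A ->
  exists P d, orthogonal_mx P /\ A = P^T *m diag_mx d *m P.
Proof.
elim: n A => [|n IH] A sA.
  by exists 1%:M, 0; split; apply/matrixP => -[].
have [a [x [xx1 xA]]] := symmx_eigenvector sA.
have [Q [sQ QQ eQ]] := reflection_to xx1.
pose B : 'M[R]_(1 + n) := Q *m A *m Q.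
have sB : symmetric_mx B by rewrite /B -{2}sQ; exact: symmx_congr.
have AE : A = Q *m B *m Q by rewrite !mulmxA QQ mul1mx -mulmxA QQ mulmx1.
have BE : B = block_mx a%:M 0 0 (drsubmx B).
  apply: symmx_block_of_row0 => //.
  by rewrite rowE !mulmxA eQ xA -scalemxAl -{1}eQ -mulmxA QQ mulmx1.
move: B sB AE BE => B sB AE BE.
have sC : symmetric_mx (drsubmx B) by rewrite /symmetric_mx trmx_drsub sB.
have [P [d [PP CE]]] := IH _ sC.
pose P1 : 'M[R]_(1 + n) := block_mx 1%:M 0 0 P.
exists (P1 *m Q), (row_mx (const_mx a) d : 'rV[R]_(1 + n)); split.
  rewrite /orthogonal_mx trmx_mul mulmxA -(mulmxA _ Q) sQ QQ mulmx1 /P1.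
  rewrite (@tr_block_mx _ 1 n 1 n) !trmx0 trmx1 (@mulmx_block _ 1 n 1 n 1 n).
  by rewrite !mulmx0 !mul0mx !addr0 !add0r mulmx1 PP -scalar_mx_block.
rewrite AE trmx_mul sQ -!mulmxA; congr (_ *m _); rewrite !mulmxA; congr (_ *m _).
rewrite BE CE.
have -> : diag_mx (row_mx (const_mx a) d : 'rV[R]_(1 + n)) = block_mx a%:M 0 0 (diag_mx d).
  by rewrite -diag_const_mx; exact: diag_mx_row.
rewrite (@tr_block_mx _ 1 n 1 n) !trmx0 trmx1 !(@mulmx_block _ 1 n 1 n 1 n).
by rewrite !(mulmx0, mul0mx, addr0, add0r, mulmx1, mul1mx).
Qed.

Lemma det_orthogonal_conj n (P D : 'M[R]_n) : orthogonal_mx P -> \det (P^T *m D *m P) = \det D.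
Proof. by move=> /mulmx1C PP; rewrite !det_mulmx mulrAC -det_mulmx PP det1 mul1r. Qed.

Lemma orthogonal_conj_diagD n (P : 'M[R]_n) (d : 'rV[R]_n) c : orthogonal_mx P ->
  P^T *m diag_mx d *m P + c%:M = P^T *m diag_mx (d + const_mx c) *m P.
Proof.
move=> /mulmx1C PP; rewrite linearD/= diag_const_mx mulmxDr mulmxDl.
by rewrite mul_mx_scalar -scalemxAl PP scalemx1.
Qed.

Lemma qform_diag n (d x : 'rV[R]_n) : qform (diag_mx d) x = \sum_i d 0 i * x 0 i ^+ 2.
Proof.
rewrite /qform dotpE; apply: eq_bigr => i _; rewrite mul_mx_diag mxE; ring.
Qed.

Lemma psd_orthogonal_conj_diag n (P : 'M[R]_n) (d : 'rV[R]_n) : orthogonal_mx P ->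
  psd (P^T *m diag_mx d *m P) <-> forall i, 0 <= d 0 i.
Proof.
move=> PP; split=> [pA i|d0].
  have /psd_congr -/(_ _ P) := pA; rewrite !mulmxA PP mul1mx -mulmxA PP mulmx1.
  by move=> /psdP/(_ (delta_mx 0 i)); rewrite qform_delta mxE eqxx.
rewrite -[X in _ *m X]trmxK; apply/psd_congr/psdP => x; rewrite qform_diag.
by apply: sumr_ge0 => i _; rewrite mulr_ge0// sqr_ge0.
Qed.

Lemma eigenvalue_orthogonal_conj_diag n (P : 'M[R]_n) (d : 'rV[R]_n) a : orthogonal_mx P ->
  eigenvalue (P^T *m diag_mx d *m P) a <-> exists i, a = d 0 i.
Proof.
move=> PP; split=> [/eigenvalueP[v vE v0]|[i ->]]; last first.
  apply/eigenvalueP; exists (delta_mx 0 i *m P).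
    by rewrite !mulmxA -(mulmxA _ P) PP mulmx1 -[_ *m diag_mx d]rowE row_diag_mx -scalemxAl.
  apply/eqP => /(congr1 (mulmx^~ P^T)); rewrite mul0mx -mulmxA PP mulmx1.
  by move=> /rowP/(_ i)/eqP; rewrite !mxE !eqxx oner_eq0.
pose w := v *m P^T.
have wE : w *m diag_mx d = a *: w.
  by have := congr1 (mulmx^~ P^T) vE; rewrite !mulmxA -!scalemxAl -(mulmxA _ P) PP mulmx1.
have /existsP[i wi] : [exists i, w 0 i != 0].
  rewrite -negb_forall; apply: contra v0 => /forallP w0.
  suff w00 : w = 0 by rewrite -[v]mulmx1 -(mulmx1C PP) mulmxA -/w w00 mul0mx.
  by apply/rowP => i; rewrite [RHS]mxE; apply/eqP; exact: w0.
exists i; apply: (mulfI wi).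
have := congr1 (fun M : 'rV[R]_n => M 0 i) wE; rewrite mul_mx_diag !mxE => ->.
exact: mulrC.
Qed.

End Spectral.

Section PsdMatrices.
Variable R : realType.

Lemma psd_spectral n (A : 'M[R]_n) : symmetric_mx A -> psd A ->
  exists P d, [/\ orthogonal_mx P, A = P^T *m diag_mx d *m P & forall i, 0 <= d 0 i].
Proof.
move=> sA pA; have [P [d [PP AE]]] := symmx_spectral sA.
by exists P, d; split=> //; apply/(psd_orthogonal_conj_diag _ PP); rewrite -AE.
Qed.

Lemma psd_det_ge0 n (A : 'M[R]_n) : symmetric_mx A -> psd A -> 0 <= \det A.
Proof.
move=> sA pA; have [P [d [PP -> d0]]] := psd_spectral sA pA.
by rewrite det_orthogonal_conj// det_diag prodr_ge0.
Qed.

Lemma psd_det_neq0_coercive n (A : 'M[R]_n) : symmetric_mx A -> psd A -> \det A != 0 ->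
  exists2 m : R, 0 < m & psd (A - m%:M).
Proof.
move=> sA pA; have [P [d [PP -> d0]]] := psd_spectral sA pA.
rewrite det_orthogonal_conj// det_diag prodf_seq_neq0 => /allP dn0.
exists (\big[Num.min/1]_i d 0 i).
  by apply: lt_bigmin => // i _; rewrite lt_neqAle d0 andbT eq_sym; exact: dn0 (mem_index_enum _).
rewrite -raddfN/= orthogonal_conj_diagD//; apply/psd_orthogonal_conj_diag => // i.
by rewrite !mxE subr_ge0; exact: bigmin_le_cond.
Qed.

Lemma psd_det_le_trace n (A : 'M[R]_n) : (0 < n)%N -> symmetric_mx A -> psd A ->
  n%:R ^+ n * \det A <= (\tr A) ^+ n.
Proof.
move=> n0 sA pA; have [P [d [PP -> d0]]] := psd_spectral sA pA.
rewrite det_orthogonal_conj// det_diag mxtrace_mulC mulmxA PP mul1mx mxtrace_diag.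
have := (@leif_AGM _ _ predT (fun i => d 0 i) (fun i _ => d0 i)).1.
by rewrite card_ord expr_div_n ler_pdivlMr ?exprn_gt0 ?ltr0n// mulrC.
Qed.

Lemma det_congr n (S A : 'M[R]_n) : \det (S *m A *m S^T) = \det S ^+ 2 * \det A.
Proof. by rewrite !det_mulmx det_tr; ring. Qed.

Lemma psd_congr_id n (A : 'M[R]_n) : symmetric_mx A -> psd A -> \det A != 0 ->
  exists S : 'M[R]_n, S *m A *m S^T = 1%:M.
Proof.
move=> sA pA; have [P [d [PP -> d0]]] := psd_spectral sA pA.
rewrite det_orthogonal_conj// det_diag prodf_seq_neq0 => /allP dn0.
pose D := diag_mx (\row_i (Num.sqrt (d 0 i))^-1); exists (D *m P).
rewrite trmx_mul !mulmxA -(mulmxA D) PP mulmx1 -!mulmxA (mulmxA P) PP mul1mx.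
rewrite tr_diag_mx !mulmx_diag -diag_const_mx; congr diag_mx.
apply/rowP => i; rewrite !mxE; have sqrtd0 : Num.sqrt (d 0 i) != 0.
  by rewrite sqrtr_eq0 -ltNge lt_neqAle d0 andbT eq_sym; exact: dn0 (mem_index_enum _).
by rewrite -{2}(sqr_sqrtr (d0 i)); field.
Qed.

Lemma prodrD_ge n (d e : 'I_n -> R) : (0 < n)%N -> (forall i, 0 <= d i) -> (forall i, 0 <= e i) ->
  \prod_i d i + \prod_i e i <= \prod_i (d i + e i).
Proof.
elim: n d e => // n IH d e _ d0 e0; case: n IH d e d0 e0 => [|n] IH d e d0 e0.
  by rewrite !big_ord_recl !big_ord0 !mulr1.
rewrite big_ord_recl [X in _ + X]big_ord_recl [leRHS]big_ord_recl.
have tail_ge := IH (fun i => d (lift ord0 i)) _ isT (fun i => d0 _) (fun i => e0 (lift ord0 i)).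
have dge0 : 0 <= \prod_i d (lift ord0 i) by apply: prodr_ge0.
have ege0 : 0 <= \prod_i e (lift ord0 i) by apply: prodr_ge0.
apply: le_trans (ler_wpM2l (addr_ge0 (d0 _) (e0 _)) tail_ge).
by rewrite mulrDl !mulrDr; apply: lerD; rewrite ?lerDl ?lerDr mulr_ge0.
Qed.

Lemma psd_det_superadd n (A B : 'M[R]_n) : (0 < n)%N ->
  symmetric_mx A -> symmetric_mx B -> psd A -> psd B -> \det A + \det B <= \det (A + B).
Proof.
move=> n0; wlog dA : A B / \det A != 0.
  move=> W sA sB pA pB; have [dA|dA] := eqVneq (\det A) 0; last exact: W.
  have [dB|dB] := eqVneq (\det B) 0; last by rewrite addrC (addrC A); exact: W.
  by rewrite dA dB addr0; apply: psd_det_ge0; [exact: symmxD|exact: psdD].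
move=> sA sB pA pB; have [S SA] := psd_congr_id sA pA dA.
have detSA : \det S ^+ 2 * \det A = 1 by rewrite -det_congr SA det1.
have S2 : 0 < \det S ^+ 2.
  rewrite exprn_even_gt0//; apply: contra_eq_neq detSA => ->.
  by rewrite expr0n mul0r eq_sym oner_eq0.
rewrite -(ler_pM2l S2) mulrDr -!det_congr mulmxDr mulmxDl SA det1.
have [P [d [PP -> d0]]] := psd_spectral (symmx_congr S sB) (psd_congr S pB).
rewrite addrC [_ + _ *m P]addrC orthogonal_conj_diagD// !det_orthogonal_conj// !det_diag.
have := @prodrD_ge n (fun i => d 0 i) (fun=> 1) n0 d0 (fun=> ler01).
by rewrite [X in _ + X]big1//; congr (_ <= _); apply: eq_bigr => i _; rewrite !mxE.
Qed.

Lemma psd_det_le n (A B : 'M[R]_n) : (0 < n)%N -> symmetric_mx A -> symmetric_mx B ->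
  psd A -> psd (B - A) -> \det A <= \det B.
Proof.
move=> n0 sA sB pA pBA; rewrite -[B](subrK A) addrC.
apply: le_trans (psd_det_superadd n0 sA (symmxB sB sA) pA pBA).
by rewrite lerDl; exact: psd_det_ge0 (symmxB sB sA) pBA.
Qed.

Lemma spec_norm_le_psd n (A : 'M[R]_n) (e : R) : symmetric_mx A -> spec_norm A <= e ->
  psd (A + e%:M) /\ psd (e%:M - A).
Proof.
move=> sA; have [P [d [PP ->]]] := symmx_spectral sA => Ae.
have dle i : `|d 0 i| <= e.
  apply: le_trans Ae; apply: ub_le_sup; last first.
    by exists (d 0 i) => //=; apply/eigenvalue_orthogonal_conj_diag => //; exists i.
  exists (\sum_i `|d 0 i|) => _ [a /= /(eigenvalue_orthogonal_conj_diag _ _ PP)[j ->] <-].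
  by rewrite (bigD1 j)//= lerDl sumr_ge0.
split; first rewrite orthogonal_conj_diagD//.
  apply/psd_orthogonal_conj_diag => // i; rewrite !mxE -lerBlDr sub0r.
  by have := dle i; rewrite ler_norml => /andP[].
rewrite addrC -mulNmx -mulmxN -raddfN/= orthogonal_conj_diagD//.
apply/psd_orthogonal_conj_diag => // i; rewrite !mxE addrC subr_ge0.
by have := dle i; rewrite ler_norml => /andP[].
Qed.

Lemma spec_norm_scalar n (c : R) : (0 < n)%N -> spec_norm (c%:M : 'M[R]_n) = `|c|.
Proof.
case: n => // n _; rewrite /spec_norm.
rewrite (_ : [set _ | _ in _] = [set `|c|]) ?sup1//.
apply/seteqP; split=> [_ [a /= /eigenvalueP[v vE v0] <-]|_ ->] /=.
  move: vE; rewrite mul_mx_scalar => /eqP.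
  by rewrite -subr_eq0 -scalerBl scaler_eq0 (negbTE v0) orbF subr_eq0 => /eqP ->.
exists c => //; apply/eigenvalueP; exists (delta_mx 0 0); first by rewrite mul_mx_scalar.
by apply/eqP => /rowP/(_ 0)/eqP; rewrite !mxE !eqxx oner_eq0.
Qed.

End PsdMatrices.

(** * The elliptic map *)

Section QOrder.
Variables (R : realType) (N : nat).
Implicit Types (p q : (R * 'M[R]_N)%type) (S : set (R * 'M[R]_N)) (e t : R).

Definition Qle p q : Prop := Qset (q.1 - p.1, q.2 - p.2).

Definition Q_upward S : Prop := forall p q, S p -> Qle p q -> S q.

Definition pshift t p : R * 'M[R]_N := (p.1 - t, p.2 + t%:M).

Lemma pshift0 p : pshift 0 p = p.
Proof. by case: p => r A; rewrite /pshift/= subr0 raddf0 addr0. Qed.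

Lemma Qle_padd p q : Qset q -> Qle p (padd p q).
Proof. by case: p q => [r A] [s P]; rewrite /Qle /padd/= !(addrC r, addrC A) !addrK. Qed.

Lemma Qset_upward : Q_upward (@Qset R N).
Proof.
move=> [r A] [s B] [/= sA [/= r0 pA]] [/= sBA [/= sr pBA]]; split=> /=.
  by rewrite -[B](subrK A); exact: symmxD.
split=> /=; first by lra.
by rewrite -[B](subrK A); exact: psdD.
Qed.

Lemma pdist_Qle p q e : SymPairs p -> SymPairs q -> pdist p q <= e ->
  Qle q (pshift e p) /\ Qle (pshift (- e) p) q.
Proof.
case: p q => [r A] [s B] sA sB; rewrite /pdist/= ge_max => /andP[rs AB].
have [pAB pBA] := spec_norm_le_psd (symmxB sA sB) AB.
move: rs; rewrite ler_norml => /andP[rs sr]; have se := @symmx_scalar R N.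
split; split=> /=.
- exact: symmxB (symmxD sA (se _)) sB.
- by split=> /=; [lra|rewrite addrAC].
- exact: symmxB sB (symmxD sA (se _)).
- by split=> /=; [lra|move: pBA; rewrite raddfN/= !opprB addrCA].
Qed.

Lemma rclosure_pshift S p e : S `<=` @SymPairs R N -> Q_upward S ->
  rclosure S p -> 0 < e -> S (pshift e p).
Proof.
move=> SS uS [sp clp] e0; have [q Sq /ltW pq] := clp e e0.
by apply: (uS _ _ Sq); have [] := pdist_Qle sp (SS q Sq) pq.
Qed.

Lemma rinterior_pshift S p e : Q_upward S -> SymPairs p -> 0 < e -> S (pshift (- e) p) ->
  rinterior S p.
Proof.
move=> uS sp e0 Sp; split=> //; exists e => // q sq /ltW pq.
by apply: (uS _ _ Sp); have [] := pdist_Qle sp sq pq.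
Qed.

Lemma rinterior_Qset (A : 'M[R]_N) (s t : R) : s < 0 -> 0 < t -> symmetric_mx A -> psd A ->
  rinterior (@Qset R N) (s, A + t%:M).
Proof.
move=> s0 t0 sA pA; have e0 : 0 < Num.min t (- s) by rewrite lt_min t0 oppr_gt0.
apply: (rinterior_pshift Qset_upward _ e0).
  exact: symmxD sA (symmx_scalar _ _).
split; first by apply: symmxD (symmx_scalar _ _); exact: symmxD sA (symmx_scalar _ _).
split; first by rewrite /= opprK -lerBrDl sub0r ge_min lexx orbT.
rewrite /= -addrA -raddfD/=; apply: psdD => //; apply: psd_scalar.
by rewrite subr_ge0 ge_min lexx.
Qed.

Lemma pdist_pshift p t : (0 < N)%N -> pdist p (pshift t p) = `|t|.
Proof.
move=> N0; rewrite /pdist /= subKr opprD addrA subrr add0r.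
by rewrite -raddfN/= spec_norm_scalar// normrN maxxx.
Qed.

Lemma dist_to_pshift S p t : (0 < N)%N -> 0 <= t -> S (pshift t p) -> (dist_to p S <= t%:E)%E.
Proof.
move=> N0 t0 Sp; apply: ereal_inf_lbound; exists (pshift t p) => //.
by rewrite pdist_pshift// ger0_norm.
Qed.

End QOrder.

Lemma det_addscalarE (R : comNzRingType) (n : nat) (A : 'M[R]_n) t :
  \det (A + t%:M) = (char_poly (- A)).[t].
Proof.
rewrite /char_poly -horner_evalE -det_map_mx; congr (\det _).
by apply/matrixP => i j; rewrite !mxE /= horner_evalE !hornerE hornerMn hornerX addrC opprK.
Qed.

Section MongeAmpere.
Variables (R : realType) (N : nat).
Hypothesis N0 : (0 < N)%N.
Implicit Types (p q : (R * 'M[R]_N)%type) (h : 'rV[R]_N -> R) (x y : 'rV[R]_N) (t : R).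

Definition MA p : R := (- p.1) ^+ (N + 2) * \det p.2.

Lemma MA_Qle p q : Qset p -> Qle p q -> MA p <= MA q.
Proof.
move=> Qp pq; have [sq _] := Qset_upward Qp pq; case: Qp => sp [p0 pp].
case: pq => _ [/= rs pqp]; apply: ler_pM.
- by rewrite exprn_ge0// oppr_ge0.
- exact: psd_det_ge0.
- by rewrite lerXn2r ?nnegrE; lra.
- exact: psd_det_le.
Qed.

Lemma MA_pshift_ge p t : 0 <= t -> Qset p -> MA p + t ^+ (N + 2) * t ^+ N <= MA (pshift t p).
Proof.
case: p => r A t0 [/= sA [/= r0 pA]]; rewrite /MA/=.
have detD := psd_det_superadd N0 sA (symmx_scalar N t) pA (psd_scalar t0).
rewrite det_scalar in detD.
have powD : (- r) ^+ (N + 2) + t ^+ (N + 2) <= (- (r - t)) ^+ (N + 2).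
  have := @prodrD_ge R (N + 2) (fun=> - r) (fun=> t); rewrite !prodr_const card_ord opprD opprK.
  by apply; rewrite ?addn2// => _; lra.
have dA := psd_det_ge0 sA pA.
have r2 : 0 <= (- r) ^+ (N + 2) by rewrite exprn_ge0// oppr_ge0.
have [t2 tN] : 0 <= t ^+ (N + 2) /\ 0 <= t ^+ N by rewrite !exprn_ge0.
apply: le_trans (ler_pM _ _ powD detD); rewrite ?addr_ge0//.
by rewrite mulrDl !mulrDr; apply: lerD; rewrite ?lerDl ?lerDr mulr_ge0.
Qed.

Lemma continuous_MA_pshift p : continuous (fun t => MA (pshift t p)).
Proof.
move=> t; rewrite /MA/=.
rewrite (_ : (fun _ => _) = horner (('X - p.1%:P) ^+ (N + 2) * char_poly (- p.2))).
  exact: continuous_horner.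
by apply/funext => s; rewrite det_addscalarE hornerM horner_exp !hornerE opprB.
Qed.

Lemma ThetaMA_upward h x : Q_upward (ThetaMA h x).
Proof.
move=> p q [Qp hp] pq; split; first exact: Qset_upward pq.
exact: le_trans hp (MA_Qle Qp pq).
Qed.

Lemma ThetaMA_sym h x : ThetaMA h x `<=` @SymPairs R N.
Proof. by move=> p [[]]. Qed.

Lemma ThetaMA_closed h x : rclosed (ThetaMA h x).
Proof.
move=> p clp.
have Thetae e : 0 < e -> ThetaMA h x (pshift e p).
  exact: rclosure_pshift (@ThetaMA_sym h x) (@ThetaMA_upward h x) clp.
case: clp => sp _; split; first split=> //; first split.
- by apply/ler_addgt0Pl => e /Thetae[[_ [/= + _]] _]; rewrite addr0 subr_le0.
- by apply: psd_of_addscalar => e /Thetae[[_ [_ +]] _].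
- have cMA := @continuous_MA_pshift p 0; rewrite -/(MA p) -[p in leRHS]pshift0.
  apply: (cvgr_to_ge (cvg_at_right_filter cMA)).
  by near=> e; have [] : ThetaMA h x (pshift e p) by apply: Thetae.
Unshelve. all: by end_near. Qed.

Lemma ThetaMA_proper_elliptic h (Omega : set 'rV[R]_N) : proper_elliptic Omega (ThetaMA h).
Proof.
move=> x _; split.
- exact: ThetaMA_sym.
- exact: ThetaMA_closed.
- pose m := Num.max 1 (h x); have m1 : 1 <= m by rewrite le_max lexx.
  exists (- m, 1%:M); split=> /=.
    split; first exact: symmx_scalar.
    by split; [rewrite /=; lra|exact: psd_scalar ler01].
  rewrite opprK det1 mulr1 (le_trans (_ : h x <= m)) ?le_max ?lexx ?orbT//.
  by rewrite -[leLHS]expr1 ler_weXn2l// addn2.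
- apply/eqP => /seteqP[_ /(_ (1, 0))] /=.
  case; first exact: trmx0.
  by move=> [_ [/= +]]; rewrite ler10.
- by move=> p q Thetap Qq; exact: ThetaMA_upward Thetap (Qle_padd p Qq).
Qed.

Lemma ThetaMA_pshift h x y p t : 0 < t -> h y <= h x + t ^+ (N + 2) * t ^+ N ->
  ThetaMA h x p -> ThetaMA h y (pshift t p).
Proof.
case: p => r A t0 hxy [Qp hp]; split.
  have [/= sA [/= r0 pA]] := Qp; split; first exact: symmxD (symmx_scalar _ _).
  by split=> /=; [lra|exact: psdD (psd_scalar (ltW t0))].
apply: le_trans (MA_pshift_ge (ltW t0) Qp); apply: le_trans hxy _.
by rewrite lerD2r.
Qed.

Lemma ThetaMA_hausdorff_continuous h (Omega : set 'rV[R]_N) :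
  open Omega -> {within Omega, continuous h} -> hausdorff_continuous Omega (ThetaMA h).
Proof.
move=> oO ch x Ox eta eta0; pose t := eta / 2; have t0 : 0 < t by rewrite divr_gt0.
have gain : 0 < t ^+ (N + 2) * t ^+ N by rewrite mulr_gt0// exprn_gt0.
have /cvgrPdist_lt/(_ _ gain) := within_open_continuous_at oO ch Ox.
rewrite -nbhs_nearE => /nbhs_normP[d /= d0 hd].
exists d => // y _ /hd/=; rewrite ltr_norml => /andP[hxy hyx].
apply: (@le_lt_trans _ _ t%:E); last by rewrite lte_fin /t; lra.
rewrite /hausdorff_dist ge_max; apply/andP; split; apply: ge_ereal_sup => _ [p Thetap <-];
  by apply: dist_to_pshift (ltW t0) _ => //; apply: ThetaMA_pshift Thetap => //; lra.
Qed.

Lemma ThetaMA_interior h x p : 0 <= h x -> Qset p -> h x < MA p -> rinterior (ThetaMA h x) p.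
Proof.
case: p => r A hx0 Qp hp; have [/= sA [/= r0 pA]] := Qp.
have : 0 < MA (r, A) by exact: le_lt_trans hp.
rewrite lt0r => /andP[]; rewrite /MA/= mulf_eq0 expf_eq0 addn2/= oppr_eq0 negb_or.
move=> /andP[rn0 dA] _; have {}r0 : 0 < - r by rewrite oppr_gt0 lt_neqAle rn0.
have [m m0 pAm] := psd_det_neq0_coercive sA pA dA.
have cMA : MA (pshift (- e) (r, A)) @[e --> 0^'+] --> MA (r, A).
  have : {for 0, continuous ((fun t => MA (pshift t (r, A))) \o -%R)}.
    by apply: continuous_comp; [exact: opp_continuous|exact: continuous_MA_pshift].
  by rewrite /prop_for /continuous_at /= oppr0 pshift0 => /cvg_at_right_filter.
have [e [e0 Thetae]] : exists e, 0 < e /\ ThetaMA h x (pshift (- e) (r, A)).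
  apply: (@filter_ex _ 0^'+); near=> e; split; first by near: e; exact: nbhs_right_gt.
  have [em er] : e <= m /\ e <= - r by split; near: e; exact: nbhs_right_le.
  split; last by apply: ltW; near: e; exact: cvgr_gt cMA _ hp.
  split; first exact: symmxD (symmx_scalar _ _).
  split=> /=; first by lra.
  rewrite raddfN/= (_ : A - e%:M = (A - m%:M) + (m - e)%:M).
    by apply: psdD => //; apply: psd_scalar; rewrite subr_ge0.
  by rewrite raddfB/= addrA subrK.
by apply: rinterior_pshift e0 Thetae => //; exact: ThetaMA_upward.
Unshelve. all: by end_near. Qed.

Lemma ThetaMA_boundary h x : 0 <= h x ->
  rboundary (ThetaMA h x) `<=`
  [set p | SymPairs p /\ (- p.1) ^+ (N + 2) * \det p.2 = h x].
Proof.
move=> hx0 p [/ThetaMA_closed[Qp hp] nint]; split; first by case: Qp.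
apply/eqP; rewrite eq_le hp andbT leNgt; apply/negP => hlt.
exact/nint/ThetaMA_interior.
Qed.

End MongeAmpere.

(** * Twice continuously differentiable functions *)

Section DirectionalDerivative.
Variable R : realType.

Lemma is_deriveP (V : normedModType R) (f : V -> R) (x v : V) (d : R) : is_derive x v f d <->
  forall e : R, 0 < e -> \forall h \near 0, `|f (x + h *: v) - f x - h * d| <= e * `|h|.
Proof.
have quotientE (h : R) : h != 0 -> d - h^-1 *: ((f \o shift x) (h *: v) - f x) =
    - (h^-1 * (f (x + h *: v) - f x - h * d)).
  by move=> h0; rewrite /GRing.scale/= (addrC x); field.
split=> [[dv dE] e e0|dfE].
  have /cvgrPdist_le/(_ e e0) : h^-1 *: ((f \o shift x) (h *: v) - f x) @[h --> 0^'] --> d.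
    by rewrite -dE; exact: dv.
  rewrite near_withinE; apply: filterS => h; have [->|h0] := eqVneq h 0.
    by rewrite scale0r addr0 subrr mul0r subr0 normr0 mulr0.
  move=> /(_ isT); rewrite quotientE// normrN normrM normfV.
  by rewrite ler_pdivrMl ?normr_gt0// [leRHS]mulrC.
have quotient_cvg : h^-1 *: ((f \o shift x) (h *: v) - f x) @[h --> 0^'] --> d.
  apply/cvgrPdist_le => e /dfE; rewrite near_withinE; apply: filterS => h dfe h0.
  by rewrite quotientE// normrN normrM normfV ler_pdivrMl ?normr_gt0// [leRHS]mulrC.
split; first by apply/cvg_ex; exists d.
exact/cvg_lim.
Qed.

Lemma is_derive_line (V : normedModType R) (f : V -> R) (x v : V) (t d : R) :
  is_derive (x + t *: v) v f d <-> is_derive t 1 (fun s : R => f (x + s *: v)) d.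
Proof.
have scale1E (h : R) : h *: (1 : R^o) = h by exact: mulr1.
rewrite (@is_deriveP V) (@is_deriveP R^o).
by split=> dfE e /dfE; apply: filterS => h; rewrite scale1E scalerDl addrA.
Qed.

Lemma is_derive_scaler (V : normedModType R) (f : V -> R) (x v : V) (d c : R) :
  is_derive x v f d -> is_derive x (c *: v) f (c * d).
Proof.
move=> /is_deriveP dfE; apply/is_deriveP => e e0.
have c1 : 0 < `|c| + 1 by rewrite ltr_wpDl.
have /nbhs_normP[r /= r0 dfe] := dfE _ (divr_gt0 e0 c1).
apply/nbhs_normP; exists (r / (`|c| + 1)) => [|h] /=; first by rewrite divr_gt0.
rewrite sub0r normrN ltr_pdivlMr// => hr.
have : `|h * c| < r by rewrite normrM (le_lt_trans _ hr)// ler_wpM2l// lerDl.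
rewrite -normrN -sub0r => /dfe; rewrite scalerA mulrA => /le_trans; apply.
by rewrite mulrAC ler_pdivrMr// -mulrA ler_wpM2l ?(ltW e0)// normrM ler_wpM2l// lerDl.
Qed.

Lemma mean_value_line (V : normedModType R) (f g : V -> R) (x v : V) :
  (forall y, is_derive y v f (g y)) ->
  exists2 t, 0 <= t <= 1 & f (x + v) - f x = g (x + t *: v).
Proof.
move=> dfE.
have dline (t : R) : is_derive t 1 (fun t : R => f (x + t *: v)) (g (x + t *: v)).
  exact: (is_derive_line f x v t _).1.
have [|t] := MVT_segment (f := fun t => f (x + t *: v)) ler01 (fun t _ => dline t).
  apply: continuous_subspaceT => t; apply: differentiable_continuous.
  by apply/derivable1_diffP; case: (dline t).
by rewrite in_itv/= scale1r scale0r addr0 subr0 mulr1; exists t.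
Qed.

Lemma derive_local_min (f g : R -> R) (q : R) : (forall t : R, is_derive t 1 f (g t)) ->
  is_derive (0 : R) 1 g q -> (\forall t \near 0, f 0 <= f t) -> 0 <= q.
Proof.
move=> df dg /nbhs_normP[r /= r0 fmin].
have g0 : g 0 = 0.
  have df0 : is_derive (0 : R) 1 f 0.
    apply: (@derive1_at_min _ f (- r) r); first by lra.
    - by move=> t _; case: (df t).
    - by rewrite in_itv/=; apply/andP; split; lra.
    - by move=> t; rewrite in_itv/= => tr; apply: fmin; rewrite /= sub0r normrN ltr_norml.
  by have [_ <-] := df 0; case: df0.
rewrite leNgt; apply/negP => q0; have q2 : 0 < - q / 2 by lra.
have /nbhs_normP[s /= s0 gq] := (@is_deriveP R^o g 0 1 q).1 dg _ q2.
pose b := Num.min r s / 2; have b0 : 0 < b by rewrite divr_gt0// lt_min r0.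
have [br bs] : b < r /\ b < s.
  have : b < Num.min r s by rewrite /b; have := b0; rewrite /b; lra.
  by rewrite lt_min => /andP[].
have [|t] := MVT (f := f) b0 (fun t _ => df t).
  apply: continuous_subspaceT => t; apply: differentiable_continuous.
  by apply/derivable1_diffP; case: (df t).
rewrite in_itv/= => /andP[t0 tb] fE; have : f 0 <= f b.
  by apply: fmin; rewrite /= sub0r normrN gtr0_norm.
have := gq t; rewrite /= sub0r normrN gtr0_norm// (lt_trans tb bs) => /(_ isT).
rewrite [t *: (1 : R^o)]mulr1 add0r g0 subr0 ler_norml => /andP[_ gt].
have gt0 : g t < 0 by have := mulr_gt0 t0 q2; lra.
have : g t * (b - 0) < 0 by rewrite subr0 nmulr_rlt0.
lra.
Qed.

End DirectionalDerivative.

Section Hessians.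
Variables (R : realType) (N : nat).
Notation pt := 'rV[R]_N.
Implicit Types (f g : pt -> R) (G : 'I_N -> pt -> R) (H K : pt -> 'M[R]_N) (x y z v w : pt).

(* The mean value theorem in one coordinate at a time. *)
Lemma C1_increment_le f G x w (e : R) : (forall y i, is_derive y (ebasis R i) f (G i y)) ->
  (forall y i, `|y - x| <= `|w| -> `|G i y - G i x| <= e) ->
  `|f (x + w) - f x - \sum_i w 0 i * G i x| <= e * \sum_i `|w 0 i|.
Proof.
move=> dfG Ge; pose p (k : nat) : pt := \row_i (x 0 i + (if (i < k)%N then w 0 i else 0)).
have p0 : p 0%N = x by apply/rowP => i; rewrite mxE addr0.
have pN : p N = x + w by apply/rowP => i; rewrite !mxE ltn_ord.
have pS (k : 'I_N) : p k.+1 = p k + w 0 k *: ebasis R k.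
  apply/rowP => i; rewrite !mxE eqxx/= ltnS leq_eqVlt -addrA; congr (_ + _).
  have [->|ik] := eqVneq i k; first by rewrite eqxx ltnn mulr1 add0r.
  by rewrite mulr0 addr0 (negbTE (_ : i != k :> nat)).
have pnear (k : 'I_N) t : 0 <= t <= 1 -> `|p k + t *: (w 0 k *: ebasis R k) - x| <= `|w|.
  move=> /andP[t0 t1]; apply: rV_norm_le => // i; apply: le_trans (coord_le_norm w i).
  rewrite !mxE eqxx/= addrAC [x 0 i + _]addrC addrK.
  have [->|ik] := eqVneq i k; last by rewrite !mulr0 addr0; case: ifP; rewrite ?normr0.
  by rewrite ltnn add0r mulr1 normrM ger0_norm// ler_piMl.
have -> : f (x + w) - f x = \sum_(k < N) (f (p k.+1) - f (p k)).
  by rewrite -(big_mkord xpredT (fun k => f (p k.+1) - f (p k))) telescope_sumr// pN p0.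
rewrite -sumrB mulr_sumr.
apply: le_trans (ler_norm_sum _ _ _) (ler_sum _ _) => k _; rewrite pS.
have dfk y : is_derive y (w 0 k *: ebasis R k) f (w 0 k * G k y) by exact: is_derive_scaler.
have [t t01 ->] := mean_value_line (p k) dfk.
by rewrite -mulrBr normrM mulrC ler_wpM2r// Ge// pnear.
Qed.

Lemma is_derive_C1 f G x v : (forall y i, is_derive y (ebasis R i) f (G i y)) ->
  (forall i, {for x, continuous (G i)}) -> is_derive x v f (\sum_i v 0 i * G i x).
Proof.
move=> dfG cG; apply/is_deriveP => e e0; pose V := \sum_i `|v 0 i|.
have V1 : 0 < V + 1 by rewrite ltr_wpDl// sumr_ge0.
have : \forall y \near x, forall i, `|G i x - G i y| <= e / (V + 1).
  apply: (@filter_forall _ _ _ (nbhs x)) => i.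
  by have /cvgrPdist_le := cG i; apply; exact: divr_gt0.
move=> /nbhs_normP[r /= r0 Gr]; apply/nbhs_normP.
have v1 : 0 < `|v| + 1 by rewrite ltr_wpDl.
exists (r / (`|v| + 1)) => [|h] /=; first by rewrite divr_gt0.
rewrite sub0r normrN ltr_pdivlMr// => hr.
have hv : `|h *: v| < r by rewrite normrZ (le_lt_trans _ hr)// ler_wpM2l// lerDl.
have Ge y i : `|y - x| <= `|h *: v| -> `|G i y - G i x| <= e / (V + 1).
  by move=> yx; rewrite distrC; apply: Gr; rewrite /= distrC (le_lt_trans yx).
have -> : h * (\sum_i v 0 i * G i x) = \sum_i (h *: v) 0 i * G i x.
  by rewrite mulr_sumr; apply: eq_bigr => i _; rewrite mxE mulrA.
apply: le_trans (C1_increment_le dfG Ge) _.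
under eq_bigr do rewrite mxE normrM; rewrite -mulr_sumr mulrCA mulrC ler_wpM2r//.
by rewrite mulrAC ler_pdivrMr// ler_pM2l// lerDl.
Qed.

Definition is_hessian f H : Prop :=
  exists G : 'I_N -> pt -> R,
    [/\ continuous f, forall i, continuous (G i),
        forall i j, continuous (fun x => H x i j),
        forall x i, is_derive x (ebasis R i) f (G i x) &
        forall x i j, is_derive x (ebasis R i) (G j) (H x i j)].

Lemma is_hessian_continuous f H : is_hessian f H -> continuous f.
Proof. by case=> G []. Qed.

Lemma is_hessian_C2_near f H x : is_hessian f H -> C2_near f x.
Proof.
move=> [G [cf cG cH dG dH]].
have pE i : partial f i = G i by apply/funext => y; rewrite /partial derive_val.
have ppE i j : partial (partial f j) i = (fun y => H y i j).
  by apply/funext => y; rewrite pE /partial derive_val.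
exists 1 => // y _; split.
- exact: cf.
- by move=> i; split; [case: (dG y i)|rewrite pE; exact: cG].
- by move=> i j; rewrite pE; case: (dH y i j).
- by move=> i j; rewrite ppE; exact: cH.
Qed.

Lemma hessianE f H x : is_hessian f H -> hessian f x = H x.
Proof.
move=> [G [_ _ _ dG dH]]; apply/matrixP => i j; rewrite mxE.
have -> : partial f j = G j by apply/funext => y; rewrite /partial derive_val.
by rewrite /partial derive_val.
Qed.

Lemma eq_is_hessian f g H K : f =1 g -> H =1 K -> is_hessian f H -> is_hessian g K.
Proof. by move=> /funext-> /funext->. Qed.

Lemma is_hessianD f g H K : is_hessian f H -> is_hessian g K ->
  is_hessian (fun x => f x + g x) (fun x => H x + K x).
Proof.
move=> [G [cf cG cH dG dH]] [G' [cg cG' cK dG' dK]].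
exists (fun i x => G i x + G' i x); split.
- by move=> x; apply: continuousD; [exact: cf|exact: cg].
- by move=> i x; apply: continuousD; [exact: cG|exact: cG'].
- move=> i j; under eq_fun do rewrite mxE.
  by move=> x; apply: continuousD; [exact: cH|exact: cK].
- by move=> x i; apply: is_deriveD.
- by move=> x i j; rewrite mxE; apply: is_deriveD.
Qed.

Lemma is_hessianZ f H c : is_hessian f H -> is_hessian (fun x => c * f x) (fun x => c *: H x).
Proof.
move=> [G [cf cG cH dG dH]]; exists (fun i x => c * G i x); split.
- exact: continuous_cstM.
- by move=> i; exact: continuous_cstM.
- by move=> i j; under eq_fun do rewrite mxE; exact: continuous_cstM.
- by move=> x i; apply: is_deriveZ.
- by move=> x i j; rewrite mxE; apply: is_deriveZ.
Qed.

Lemma is_hessian_cst c : is_hessian (fun=> c) (fun=> 0).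
Proof.
exists (fun _ _ => 0); split.
- by move=> x; exact: cst_continuous.
- by move=> i x; exact: cst_continuous.
- by move=> i j x; exact: cst_continuous.
- by move=> x i; exact: is_derive_cst.
- by move=> x i j; rewrite mxE; exact: is_derive_cst.
Qed.

Lemma is_hessian_addr f H c : is_hessian f H -> is_hessian (fun x => f x + c) H.
Proof.
by move=> fH; apply: eq_is_hessian (is_hessianD fH (is_hessian_cst c)) => // x; rewrite addr0.
Qed.

Lemma is_hessian_sum (I : Type) (r : seq I) (f : I -> pt -> R) (H : I -> pt -> 'M[R]_N) :
  (forall i, is_hessian (f i) (H i)) ->
  is_hessian (fun x => \sum_(i <- r) f i x) (fun x => \sum_(i <- r) H i x).
Proof.
move=> fH; elim: r => [|i r IH].
  by apply: eq_is_hessian (is_hessian_cst 0) => x; rewrite big_nil.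
by apply: eq_is_hessian (is_hessianD (fH i) IH) => x; rewrite big_cons.
Qed.

Lemma is_derive_shift (V : normedModType R) (g : V -> R) (x v z : V) (d : R) :
  is_derive (x + z) v g d -> is_derive x v (fun y : V => g (y + z)) d.
Proof.
move=> /is_deriveP dg; apply/is_deriveP => e /dg; apply: filterS => h.
by rewrite (addrAC x).
Qed.

Lemma is_hessian_shift f H z : is_hessian f H ->
  is_hessian (fun x => f (x + z)) (fun x => H (x + z)).
Proof.
move=> [G [cf cG cH dG dH]]; exists (fun i x => G i (x + z)); split.
- exact: continuous_shift.
- by move=> i; exact: continuous_shift.
- by move=> i j; exact: (continuous_shift (g := fun x => H x i j)).
- by move=> x i; exact: is_derive_shift.
- by move=> x i j; exact: is_derive_shift.
Qed.

Lemma is_hessian_local_min_psd f H x : is_hessian f H ->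
  (\forall y \near x, f x <= f y) -> psd (H x).
Proof.
move=> [G [cf cG cH dG dH]] fmin; apply/psdP => v.
have df y : is_derive y v f (\sum_i v 0 i * G i y) by apply: is_derive_C1 => i; exact: cG.
have ddf : is_derive x v (fun y => \sum_i v 0 i * G i y) (qform (H x) v).
  have dG1 j : is_derive x v (G j) (\sum_i v 0 i * H x i j).
    by apply: is_derive_C1 => i; exact: cH.
  have := is_derive_sum (fun j => is_deriveZ (v 0 j) (dG1 j)); rewrite fct_sumE /qform dotpE.
  by under [X in _ -> is_derive _ _ _ X]eq_bigr do rewrite mulrC mxE.
apply: (@derive_local_min _ (fun t => f (x + t *: v)) (fun t => \sum_i v 0 i * G i (x + t *: v))).
- by move=> t; exact: ((is_derive_line f x v t _).1 (df _)).
- rewrite -{1}[x]addr0 -(scale0r v) in ddf.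
  exact: ((is_derive_line _ x v 0 _).1 ddf).
- have line_cvg : x + t *: v @[t --> (0 : R)] --> x + 0 *: v.
    by apply: cvgD; [exact: cvg_cst|exact: scalel_continuous].
  by rewrite scale0r addr0 in line_cvg *; exact: line_cvg fmin.
Qed.

End Hessians.

(** * Ridge functions, plane waves and the resolvent *)

Section ConstantCoefficientOperator.
Variables (R : realType) (m N : nat) (S : 'M[R]_(m, N)).

Definition ellop (H : 'M[R]_N) : R := \tr (S *m H *m S^T).

Lemma ellopD H K : ellop (H + K) = ellop H + ellop K.
Proof. by rewrite /ellop mulmxDr mulmxDl mxtraceD. Qed.

Lemma ellopZ c H : ellop (c *: H) = c * ellop H.
Proof. by rewrite /ellop -scalemxAr -scalemxAl mxtraceZ. Qed.

Lemma ellop0 : ellop 0 = 0.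
Proof. by rewrite /ellop mulmx0 mul0mx mxtrace0. Qed.

Lemma ellop_sum (I : Type) (r : seq I) (H : I -> 'M[R]_N) :
  ellop (\sum_(i <- r) H i) = \sum_(i <- r) ellop (H i).
Proof. exact: (big_morph _ ellopD ellop0). Qed.

Lemma ellop_ge0 H : psd H -> 0 <= ellop H.
Proof. by move=> pH; apply/psd_trace_ge0/psd_congr. Qed.

Lemma ellop_outer (xi : 'rV[R]_N) : ellop (xi^T *m xi) = dotp (xi *m S^T) (xi *m S^T).
Proof.
rewrite /ellop mulmxA -mulmxA mxtrace_mulC -[S *m xi^T]trmxK trmx_mul trmxK.
by rewrite mulmx_tr_dotp mxtrace_scalar mulr1n.
Qed.

Lemma continuous_ellop (H : 'rV[R]_N -> 'M[R]_N) :
  (forall i j, continuous (fun x => H x i j)) -> continuous (fun x => ellop (H x)).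
Proof.
move=> cH; rewrite (_ : (fun _ => _) =
    (fun x => \sum_i \sum_k S i k * (\sum_j S i j * H x j k))).
  do 2 apply: continuous_sum => ?; apply: continuous_cstM.
  by apply: continuous_sum => ?; exact: continuous_cstM.
apply/funext => x; apply: eq_bigr => i _; rewrite mxE.
by apply: eq_bigr => k _; rewrite !mxE mulrC.
Qed.

End ConstantCoefficientOperator.

Section RidgeFunctions.
Variables (R : realType) (N : nat).
Notation pt := 'rV[R]_N.
Implicit Types (x y v xi a : pt) (c : R).

Lemma is_derive_ridge (g : R -> R) (d : R) xi x v c : is_derive (dotp x xi + c) 1 g d ->
  is_derive x v (fun y => g (dotp y xi + c)) (d * dotp v xi).
Proof.
move=> dg; rewrite -[x]addr0 -(scale0r v); apply: (is_derive_line _ x v 0 _).2.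
have affineE (s : R) : dotp (x + s *: v) xi + c = (dotp x xi + c) + s * dotp v xi.
  by rewrite dotpDl dotpZl addrAC.
under eq_fun do rewrite affineE.
apply: (is_derive1_comp (f := g) (g := fun s => (dotp x xi + c) + s * dotp v xi)).
  by rewrite mul0r addr0.
apply/(@is_deriveP _ R^o) => e e0; apply: filterE => h; rewrite [h *: (1 : R^o)]mulr1.
by rewrite (_ : _ - _ = 0) ?normr0 ?mulr_ge0 ?(ltW e0)//; ring.
Qed.

Lemma continuous_ridge (g : R -> R) xi c : continuous g ->
  continuous (fun x => g (dotp x xi + c)).
Proof.
move=> cg x; apply: (@continuous_comp _ _ _ (fun x => dotp x xi + c) g); last exact: cg.
by apply: continuousD; [exact: continuous_dotpr|exact: cst_continuous].
Qed.

Lemma is_hessian_ridge (g g' g'' : R -> R) xi c :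
  (forall t : R, is_derive t 1 g (g' t)) -> (forall t : R, is_derive t 1 g' (g'' t)) ->
  continuous g'' ->
  is_hessian (fun x => g (dotp x xi + c)) (fun x => g'' (dotp x xi + c) *: (xi^T *m xi)).
Proof.
move=> dg dg' cg''.
have derive_continuous (f f' : R -> R) : (forall t : R, is_derive t 1 f (f' t)) -> continuous f.
  by move=> df t; apply: differentiable_continuous; apply/derivable1_diffP; case: (df t).
have eE i : dotp (ebasis R i) xi = xi 0 i by rewrite dotpC dotp_delta.
exists (fun i x => xi 0 i * g' (dotp x xi + c)); split.
- exact/continuous_ridge/(derive_continuous _ _ dg).
- move=> i; apply: continuous_cstM.
  exact/continuous_ridge/(derive_continuous _ _ dg').
- move=> i j; under eq_fun do rewrite !mxE big_ord1 !mxE mulrC.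
  exact/continuous_cstM/continuous_ridge.
- by move=> x i; rewrite mulrC -eE; exact: is_derive_ridge.
- move=> x i j.
  have -> : (g'' (dotp x xi + c) *: (xi^T *m xi)) i j =
      xi 0 j *: (g'' (dotp x xi + c) * dotp (ebasis R i) xi).
    by rewrite eE !mxE big_ord1 !mxE /GRing.scale/=; ring.
  by apply: is_deriveZ; exact: is_derive_ridge.
Qed.

Lemma is_hessian_ridge_poly (p : {poly R}) xi c :
  is_hessian (fun x => p.[dotp x xi + c])
             (fun x => p^`()^`().[dotp x xi + c] *: (xi^T *m xi)).
Proof.
by apply: (@is_hessian_ridge (horner p) (horner p^`())); exact: continuous_horner.
Qed.

Lemma is_hessian_affine xi c : is_hessian (fun x => dotp x xi + c) (fun=> 0).
Proof.
apply: eq_is_hessian (is_hessian_ridge_poly 'X xi c) => x; first by rewrite hornerX.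
by rewrite derivX derivC horner0 scale0r.
Qed.

Lemma is_hessian_sqr_affine xi c :
  is_hessian (fun x => (dotp x xi + c) ^+ 2) (fun=> 2 *: (xi^T *m xi)).
Proof.
apply: eq_is_hessian (is_hessian_ridge_poly 'X^2 xi c) => x; first by rewrite hornerXn.
by rewrite derivXn derivMn derivX !hornerE.
Qed.

Lemma sum_outer_ebasis : \sum_i (ebasis R i)^T *m ebasis R i = 1%:M :> 'M[R]_N.
Proof.
apply/matrixP => i j; rewrite summxE (bigD1 i)//= big1 => [|k ki].
  by rewrite !mxE big_ord1 !mxE !eqxx/= mul1r addr0 eq_sym.
by rewrite !mxE big_ord1 !mxE/= eq_sym (negbTE ki) mul0r.
Qed.

Lemma is_hessian_sqdist a : is_hessian (fun x => dotp (x - a) (x - a)) (fun=> 2%:M).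
Proof.
apply: eq_is_hessian (is_hessian_sum (index_enum 'I_N)
   (fun i => is_hessian_sqr_affine (ebasis R i) (- a 0 i))) => x.
  by rewrite dotpE; apply: eq_bigr => i _; rewrite dotp_delta !mxE expr2.
by rewrite -scaler_sumr sum_outer_ebasis scalemx1.
Qed.

Lemma penalized_min (w : pt -> R) (C eta : R) : continuous w -> (forall x, - C <= w x) ->
  0 < eta -> exists x1, forall x, w x1 + eta * dotp x1 x1 <= w x + eta * dotp x x.
Proof.
move=> cw wC eta0; pose g x := w x + eta * dotp x x.
have cpen : continuous (fun x : pt => eta * dotp x x) by exact/continuous_cstM/continuous_dotpp.
have cg : continuous g by move=> x; exact: (continuousD (cw x) (cpen x)).
pose rho := 1 + (w 0 + C) / eta; have wC0 : 0 <= w 0 + C by have := wC 0; lra.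
have rho1 : 1 <= rho by rewrite lerDl divr_ge0// ltW.
have rho0 : 0 < rho by exact: lt_le_trans rho1.
have in0 : closed_ball (0 : pt) rho 0 by exact: closed_ballxx.
have [||x1 _ x1min] := compact_EVT_min (f := g) (ex_intro _ _ in0).
- exact: compact_closed_ball.
- exact: continuous_subspaceT.
exists x1 => x; have [xrho|xrho] := leP `|x| rho.
  by apply: x1min; rewrite inE; apply/closed_ballP; rewrite ?subr0.
have /le_trans -> // : g x1 <= g 0 by apply: x1min; rewrite inE.
rewrite /g dotp0l mulr0 addr0.
have : rho <= dotp x x.
  apply: le_trans (sqr_norm_le_dotpp x); apply: (le_trans (ltW xrho)).
  by rewrite expr2 ler_peMl// (le_trans rho1)// ltW.
rewrite -(ler_pM2l eta0) mulrDr mulr1 mulrCA divff ?gt_eqF// mulr1.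
by have := wC x; lra.
Qed.

End RidgeFunctions.

Section PlaneWaves.
Variables (R : realType) (N : nat).
Notation pt := 'rV[R]_N.
Implicit Types (f g w : pt -> R) (x xi : pt) (c k : R).

Definition plane_waves (l : seq (R * pt * R)) (x : pt) : R :=
  \sum_(t <- l) t.1.1 * cos (dotp x t.1.2 + t.2).

Definition is_trig f := exists l, f =1 plane_waves l.

Lemma eq_is_trig f g : f =1 g -> is_trig f -> is_trig g.
Proof. by move=> /funext->. Qed.

Lemma is_trigD f g : is_trig f -> is_trig g -> is_trig (fun x => f x + g x).
Proof.
move=> [l fl] [l' gl]; exists (l ++ l') => x.
by rewrite /plane_waves big_cat fl gl.
Qed.

Lemma is_trigZ c f : is_trig f -> is_trig (fun x => c * f x).
Proof.
move=> [l fl]; exists [seq (c * t.1.1, t.1.2, t.2) | t <- l] => x.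
by rewrite /plane_waves big_map fl mulr_sumr; apply: eq_bigr => t _ /=; rewrite mulrA.
Qed.

Lemma is_trig_cos xi c : is_trig (fun x => cos (dotp x xi + c)).
Proof. by exists [:: (1, xi, c)] => x; rewrite /plane_waves big_seq1 mul1r. Qed.

Lemma is_trig_cst c : is_trig (fun=> c).
Proof.
by exists [:: (c, 0, 0)] => x; rewrite /plane_waves big_seq1/= dotpC dotp0l addr0 cos0 mulr1.
Qed.

Lemma is_trig_sum (I : Type) (r : seq I) (f : I -> pt -> R) : (forall i, is_trig (f i)) ->
  is_trig (fun x => \sum_(i <- r) f i x).
Proof.
move=> tf; elim: r => [|i r IH].
  by apply: eq_is_trig (is_trig_cst 0) => x; rewrite big_nil.
by apply: eq_is_trig (is_trigD (tf i) IH) => x; rewrite big_cons.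
Qed.

Lemma is_trigM f g : is_trig f -> is_trig g -> is_trig (fun x => f x * g x).
Proof.
move=> [l fl] [l' gl].
pose summand (s t : R * pt * R) x := s.1.1 * t.1.1 / 2 *
  (cos (dotp x (s.1.2 + t.1.2) + (s.2 + t.2)) + cos (dotp x (s.1.2 - t.1.2) + (s.2 - t.2))).
apply: (@eq_is_trig (fun x => \sum_(s <- l) \sum_(t <- l') summand s t x)).
  move=> x; rewrite fl gl mulr_suml; apply: eq_bigr => s _.
  rewrite mulr_sumr; apply: eq_bigr => t _; rewrite /summand dotpDr dotpBr.
  by rewrite addrACA [X in _ + cos X]addrACA -opprD cosD cosB; field.
do 2 apply: is_trig_sum => ?; apply/is_trigZ/is_trigD; exact: is_trig_cos.
Qed.

Lemma is_trig_prod (I : Type) (r : seq I) (f : I -> pt -> R) : (forall i, is_trig (f i)) ->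
  is_trig (fun x => \prod_(i <- r) f i x).
Proof.
move=> tf; elim: r => [|i r IH].
  by apply: eq_is_trig (is_trig_cst 1) => x; rewrite big_nil.
by apply: eq_is_trig (is_trigM (tf i) IH) => x; rewrite big_cons.
Qed.

(* Plane waves are eigenfunctions of every constant coefficient operator, so the
   resolvent acts on each coefficient separately. *)
Lemma resolvent_trig m (S : 'M[R]_(m, N)) k f : is_trig f ->
  exists w H, [/\ is_hessian w H, forall x, w x - k ^+ 2 * ellop S (H x) = f x &
    exists C, forall x, `|w x| <= C].
Proof.
move=> [l fl]; pose lam (xi : pt) := dotp (xi *m S^T) (xi *m S^T).
have lam1 xi : 1 + k ^+ 2 * lam xi != 0.
  by rewrite gt_eqF// ltr_wpDr// mulr_ge0 ?sqr_ge0 ?dotpp_ge0.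
pose c (t : R * pt * R) := t.1.1 / (1 + k ^+ 2 * lam t.1.2).
exists (fun x => \sum_(t <- l) c t * cos (dotp x t.1.2 + t.2)),
  (fun x => \sum_(t <- l) c t *: (- cos (dotp x t.1.2 + t.2) *: (t.1.2^T *m t.1.2))); split.
- apply: is_hessian_sum => t; apply: is_hessianZ.
  apply: (@is_hessian_ridge _ _ cos (fun t => - sin t) (fun t => - cos t)) => s.
  by apply: continuousN; exact: continuous_cos.
- move=> x; rewrite fl ellop_sum mulr_sumr -sumrB; apply: eq_bigr => t _.
  by rewrite !ellopZ ellop_outer -/(lam _) /c; field.
- exists (\sum_(t <- l) `|c t|) => x; apply: le_trans (ler_norm_sum _ _ _) _.
  by apply: ler_sum => t _; rewrite normrM ler_piMr// cos_max.
Qed.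

Lemma resolvent_ge m (S : 'M[R]_(m, N)) k b w H : is_hessian w H ->
  (exists C, forall x, `|w x| <= C) -> (forall x, b <= w x - k ^+ 2 * ellop S (H x)) ->
  forall x, b <= w x.
Proof.
move=> wH [C wC] bw x0; apply/ler_addgt0Pl => e e0.
pose A := k ^+ 2 * ellop S 2%:M + dotp x0 x0.
have lap0 : 0 <= k ^+ 2 * ellop S 2%:M by rewrite mulr_ge0 ?sqr_ge0//; exact/ellop_ge0/psd_scalar.
have A1 : 0 < A + 1 by rewrite ltr_wpDl// addr_ge0// dotpp_ge0.
pose eta := e / (A + 1); have eta0 : 0 < eta by rewrite divr_gt0.
have wCN x : - C <= w x by have := wC x; rewrite ler_norml => /andP[].
have [x1 x1min] := penalized_min (is_hessian_continuous wH) wCN eta0.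
have penH : is_hessian (fun x => w x + eta * dotp x x) (fun x => H x + eta *: 2%:M).
  apply/is_hessianD/is_hessianZ => //.
  by apply: eq_is_hessian (is_hessian_sqdist 0) => // x; rewrite subr0.
have pH : psd (H x1 + eta *: 2%:M).
  by apply: (is_hessian_local_min_psd penH); apply: filterE => x; exact: x1min.
have := ellop_ge0 S pH.
rewrite ellopD ellopZ => /(ler_wpM2l (sqr_ge0 k)); rewrite mulr0 mulrDr mulrCA => lap1.
have eA : eta * A <= e by rewrite /eta mulrAC ler_pdivrMr// ler_pM2l// lerDl.
have := mulr_ge0 (ltW eta0) (dotpp_ge0 x1); have := x1min x0; have := bw x1.
by rewrite mulrDr in eA; lra.
Qed.

End PlaneWaves.

(** * A trigonometric partition of unity *)

Fixpoint bernstein (R : comNzRingType) (s : R) (n k : nat) : R :=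
  if n is n'.+1 then
    (1 - s) * bernstein s n' k + (if k is k'.+1 then s * bernstein s n' k' else 0)
  else (k == 0%N)%:R.

Section BernsteinIdentities.
Variables (R : comNzRingType) (s : R).

Lemma bernstein_gt n k : (n < k)%N -> bernstein s n k = 0.
Proof.
elim: n k => [|n IH] [|k]//= nk.
by rewrite !IH ?mulr0 ?addr0// (leq_trans _ nk).
Qed.

Lemma bernstein_sumS n (F : nat -> R) :
  \sum_(k < n.+2) bernstein s n.+1 k * F k =
  (1 - s) * (\sum_(k < n.+1) bernstein s n k * F k) +
  s * (\sum_(k < n.+1) bernstein s n k * F k.+1).
Proof.
under eq_bigr => k _ do rewrite /= mulrDl -mulrA.
rewrite big_split/=; congr (_ + _).
  by rewrite big_ord_recr/= bernstein_gt// mul0r mulr0 addr0 mulr_sumr.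
rewrite big_ord_recl/= mul0r add0r mulr_sumr; apply: eq_bigr => k _.
by rewrite /bump/= mulrA.
Qed.

Lemma bernstein_sum1 n : \sum_(k < n.+1) bernstein s n k = 1.
Proof.
under eq_bigr do rewrite -[bernstein _ _ _]mulr1.
elim: n => [|n IH]; first by rewrite big_ord1 /= mulr1.
by rewrite (bernstein_sumS n (fun=> 1)) IH; ring.
Qed.

Lemma bernstein_variance n c :
  \sum_(k < n.+1) bernstein s n k * (k%:R - c) ^+ 2 =
  n%:R * s * (1 - s) + (n%:R * s - c) ^+ 2.
Proof.
elim: n c => [|n IH] c; first by rewrite big_ord1/=; ring.
rewrite (bernstein_sumS n (fun k => (k%:R - c) ^+ 2)) IH.
have shift (k : 'I_n.+1) : k.+1%:R - c = k%:R - (c - 1) :> R by rewrite -natr1; ring.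
by under [X in _ + s * X]eq_bigr => k _ do rewrite shift; rewrite IH -natr1; ring.
Qed.

End BernsteinIdentities.

Section BernsteinConcentration.
Variables (R : realType) (s : R).
Hypothesis s01 : 0 <= s <= 1.

Lemma bernstein_ge0 n k : 0 <= bernstein s n k.
Proof.
case/andP: s01 => s0 s1; elim: n k => [|n IH] k /=; first exact: ler0n.
rewrite addr_ge0// ?mulr_ge0// ?subr_ge0//.
by case: k => // k; rewrite mulr_ge0.
Qed.

Lemma bernstein_chebyshev n (g : R) : (0 < n)%N -> 0 < g ->
  \sum_(k < n.+1) bernstein s n k * (g <= `|s - k%:R / n%:R|)%R%:R <= (n%:R * g ^+ 2)^-1.
Proof.
move=> n0 g0; have nR0 : 0 < n%:R :> R by rewrite ltr0n.
have ng0 : 0 < n%:R * g by apply: mulr_gt0.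
apply: (@le_trans _ _ (\sum_(k < n.+1)
    bernstein s n k * (k%:R - n%:R * s) ^+ 2 / (n%:R * g) ^+ 2)).
  apply: ler_sum => k _; rewrite -mulrA ler_wpM2l ?bernstein_ge0//.
  have [gs|_] := leP g; last by rewrite divr_ge0 ?sqr_ge0.
  rewrite ler_pdivlMr ?exprn_gt0// mul1r -[leRHS]real_normK ?num_real//.
  rewrite lerXn2r ?nnegrE ?(ltW ng0)// -ler_pdivlMl//; apply: (le_trans gs).
  by rewrite -[leRHS]ger0_norm ?mulr_ge0 ?invr_ge0 ?(ltW nR0)// normrM normr_id -normrM mulrBr
    mulKf ?gt_eqF// mulrC distrC.
rewrite -mulr_suml bernstein_variance subrr expr0n/= addr0.
have ns : n%:R * s * (1 - s) <= n%:R.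
  by case/andP: s01 => s0 s1; rewrite -mulrA ler_piMr ?(ltW nR0)//; nra.
apply: (le_trans (ler_wpM2r _ ns)); first by rewrite invr_ge0 sqr_ge0.
by rewrite exprMn expr2 -mulrA invfM mulrA divff ?gt_eqF// mul1r.
Qed.

End BernsteinConcentration.

Section TrigCoordinate.
Variable R : realType.

Lemma cosB_ge (a b d : R) : 0 <= a -> b <= pi -> 0 <= d -> d <= b - a ->
  1 - cos d <= cos a - cos b.
Proof.
move=> a0 bpi d0 dba.
have cosd : cos (b - a) <= cos d.
  by rewrite leNgt ltr_cos ?in_itv/= -?leNgt//; apply/andP; split; lra.
apply: (@le_trans _ _ (1 - cos (b - a))); first by lra.
pose A := a / 2; pose B := b / 2.
have [aE bE] : a = A *+ 2 /\ b = B *+ 2 by split; rewrite mulr2n -splitr.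
have [sA cB sBA] : [/\ 0 <= sin A, 0 <= cos B & 0 <= sin (B - A)].
  by split; [apply: sin_ge0_pi|apply: cos_ge0_pihalf|apply: sin_ge0_pi]; rewrite /A /B; lra.
rewrite -subr_ge0 cosB aE bE !sin_mulr2n !cos_mulr2n.
have -> : cos A ^+ 2 = 1 - sin A ^+ 2 by rewrite cos2sin2.
have := mulr_ge0 (mulr_ge0 sA cB) sBA; by rewrite sinB !mulr2n; lra.
Qed.

Variable rho : R.
Hypothesis rho0 : 0 < rho.

Let freq : R := pi / (2 * rho).

Definition trig_coord (t : R) : R := (1 - cos (freq * (t + rho))) / 2.
Definition trig_node (n k : nat) : R := acos (1 - 2 * (k%:R / n%:R)) / freq - rho.

Let freq_gt0 : 0 < freq. Proof. by rewrite divr_gt0 ?pi_gt0// mulr_gt0. Qed.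

Let freq_le_pi t : (freq * t <= pi) = (t <= 2 * rho).
Proof.
by rewrite /freq mulrAC ler_pdivrMr ?mulr_gt0// ler_pM2l ?pi_gt0.
Qed.

Lemma trig_coord01 t : 0 <= trig_coord t <= 1.
Proof.
rewrite /trig_coord; have := cos_le1 (freq * (t + rho)).
by have := cos_geN1 (freq * (t + rho)); lra.
Qed.

Let node_arg n k : (0 < n)%N -> (k <= n)%N -> -1 <= 1 - 2 * (k%:R / n%:R : R) <= 1.
Proof.
move=> n0 kn; have : 0 <= (k%:R / n%:R : R) <= 1.
  by rewrite divr_ge0//= ler_pdivrMr ?ltr0n// mul1r ler_nat.
by move=> /andP[? ?]; lra.
Qed.

Lemma trig_node_bound n k : (0 < n)%N -> (k <= n)%N -> `|trig_node n k| <= rho.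
Proof.
move=> n0 kn; have arg01 := node_arg n0 kn; rewrite /trig_node ler_norml.
have a0 : 0 <= acos (1 - 2 * (k%:R / n%:R)) / freq by rewrite divr_ge0 ?acos_ge0// ltW// freq_gt0.
have : acos (1 - 2 * (k%:R / n%:R)) / freq <= 2 * rho.
  by rewrite -freq_le_pi mulrC divfK ?gt_eqF// acos_lepi.
by move: a0; lra.
Qed.

Lemma trig_coord_node n k : (0 < n)%N -> (k <= n)%N ->
  trig_coord (trig_node n k) = k%:R / n%:R.
Proof.
move=> n0 kn; rewrite /trig_coord /trig_node subrK mulrCA divff ?gt_eqF// mulr1.
by rewrite acosK ?in_itv/= ?node_arg//; field; rewrite pnatr_eq0 -lt0n.
Qed.

Lemma trig_coord_gap (t t' d : R) : `|t| <= rho -> `|t'| <= rho -> 0 <= d -> d <= `|t - t'| ->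
  (1 - cos (freq * d)) / 2 <= `|trig_coord t - trig_coord t'|.
Proof.
wlog tt' : t t' / t' <= t => [W tr t'r d0 dt|].
  have [tt'|/ltW tt'] := leP t' t; first exact: W.
  by rewrite distrC; apply: W => //; rewrite distrC.
rewrite !ler_norml => /andP[_ tr] /andP[t'r _] d0; rewrite ger0_norm ?subr_ge0// => dt.
suff : 1 - cos (freq * d) <= cos (freq * (t' + rho)) - cos (freq * (t + rho)).
  by move=> gap; apply: le_trans (ler_norm _); rewrite /trig_coord; lra.
apply: cosB_ge.
- by rewrite pmulr_rge0//; lra.
- by rewrite freq_le_pi; lra.
- by rewrite pmulr_rge0.
- by rewrite -mulrBr ler_pM2l//; lra.
Qed.

Lemma bernstein_trig_tail (d e : R) : 0 < d <= rho -> 0 < e ->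
  exists2 n, (0 < n)%N & forall t, `|t| <= rho ->
    \sum_(k < n.+1) bernstein (trig_coord t) n k * (d <= `|t - trig_node n k|)%R%:R <= e.
Proof.
move=> /andP[d0 drho] e0; pose g := (1 - cos (freq * d)) / 2.
have g0 : 0 < g.
  have fd0 : 0 < freq * d by rewrite mulr_gt0.
  have fdpi : freq * d <= pi by rewrite freq_le_pi; lra.
  rewrite divr_gt0// subr_gt0 -cos0 ltr_cos// in_itv/= ?lexx ?(ltW (pi_gt0 R))//.
  by rewrite (ltW fd0).
pose n := (Num.truncn (e * g ^+ 2)^-1).+1; exists n => // t trho.
have n0 : 0 < n%:R :> R by rewrite ltr0n.
apply: (@le_trans _ _ (n%:R * g ^+ 2)^-1); last first.
  have [ng2 eg2] : 0 < n%:R * g ^+ 2 /\ 0 < e * g ^+ 2 by split; apply/mulr_gt0/exprn_gt0.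
  by rewrite -div1r ler_pdivrMr// mulrCA -ler_pdivrMr// div1r ltW// truncnS_gt.
apply: le_trans (bernstein_chebyshev (trig_coord01 t) _ g0) => //.
apply: ler_sum => k _; rewrite ler_wpM2l ?bernstein_ge0 ?trig_coord01// ler_nat.
have kn : (k <= n)%N by rewrite -ltnS.
have [dt|//] := leP d; rewrite -trig_coord_node//.
by rewrite (trig_coord_gap trho (trig_node_bound _ kn) (ltW d0) dt).
Qed.

End TrigCoordinate.

Section TrigPartition.
Variables (R : realType) (N : nat).
Notation pt := 'rV[R]_N.

Lemma is_trig_bernstein (f : pt -> R) n k : is_trig f -> is_trig (fun x => bernstein (f x) n k).
Proof.
move=> tf; elim: n k => [|n IH] k /=; first exact: is_trig_cst.
have tf' : is_trig (fun x => 1 - f x).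
  apply: (@eq_is_trig _ _ (fun x => 1 + (-1) * f x)) => [x|]; first by rewrite mulN1r.
  by apply: is_trigD; [exact: is_trig_cst|exact: is_trigZ].
apply: is_trigD; first exact: is_trigM.
by case: k => [|k]; [exact: is_trig_cst|exact: is_trigM].
Qed.

Lemma is_trig_trig_coord (rho : R) (y : pt) i :
  is_trig (fun x => trig_coord rho (x 0 i - y 0 i)).
Proof.
pose a : R := pi / (2 * rho).
apply: (@eq_is_trig _ _ (fun x : pt =>
    2^-1 + (- 2^-1) * cos (dotp x (a *: ebasis R i) + a * (rho - y 0 i)))).
  move=> x; rewrite dotpZr dotp_delta -mulrDr addrCA addrA [rho + _]addrC -addrA /trig_coord -/a.
  by rewrite [rho - _]addrC addrA; field.
by apply: is_trigD; [exact: is_trig_cst|apply: is_trigZ; exact: is_trig_cos].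
Qed.

Lemma sum_prod_marginal (A : comNzRingType) (I J : finType) (f : I -> J -> A) (i : I) (c : J -> A) :
  (forall j, \sum_m f j m = 1) ->
  \sum_(k : {ffun I -> J}) (\prod_j f j (k j)) * c (k i) = \sum_m f i m * c m.
Proof.
move=> f1; pose F j m := if j == i then f j m * c m else f j m.
transitivity (\sum_(k : {ffun I -> J}) \prod_j F j (k j)).
  apply: eq_bigr => k _; rewrite (bigD1 i)//= [RHS](bigD1 i)//= /F eqxx mulrAC.
  by congr (_ * _); apply: eq_bigr => j ji; rewrite (negbTE ji).
rewrite -(bigA_distr_bigA F) [LHS](bigD1 i)//= [X in _ * X]big1 ?mulr1 => [|j ji].
  by apply: eq_bigr => m _; rewrite /F eqxx.
by rewrite -(f1 j); apply: eq_bigr => m _; rewrite /F (negbTE ji).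
Qed.

(* Tensor products of the Bernstein polynomials in the shifted cosines of the coordinates. *)
Lemma trig_partition (y : pt) (rho d e : R) : 0 < d <= rho -> 0 < e ->
  exists (K : finType) (b : K -> pt -> R) (node : K -> pt),
    [/\ forall k, is_trig (b k), forall k x, 0 <= b k x,
        forall x, \sum_k b k x = 1 &
        forall x, `|x - y| <= rho -> \sum_k b k x * (d <= `|x - node k|)%R%:R <= e].
Proof.
move=> drho e0; have [d0 rho0] : 0 < d /\ 0 < rho.
  by case/andP: drho => d0 /(lt_le_trans d0).
have eN : 0 < e / N.+1%:R by rewrite divr_gt0.
have [n n0 tail] := bernstein_trig_tail rho0 drho eN.
pose s i (x : pt) := trig_coord rho (x 0 i - y 0 i).
pose b (k : {ffun 'I_N -> 'I_n.+1}) (x : pt) := \prod_i bernstein (s i x) n (k i).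
pose node (k : {ffun 'I_N -> 'I_n.+1}) : pt := y + \row_i trig_node rho n (k i).
have b0 k x : 0 <= b k x by apply: prodr_ge0 => i _; exact/bernstein_ge0/trig_coord01.
exists {ffun 'I_N -> 'I_n.+1}, b, node; split=> //.
- by move=> k; apply: is_trig_prod => i; exact/is_trig_bernstein/is_trig_trig_coord.
- move=> x; rewrite /b -(bigA_distr_bigA (fun i (m : 'I_n.+1) => bernstein (s i x) n m)).
  by apply: big1 => i _; exact: bernstein_sum1.
move=> x xy; pose far i (m : 'I_n.+1) : R := (d <= `|x 0 i - y 0 i - trig_node rho n m|)%R%:R.
apply: (@le_trans _ _ (\sum_k \sum_i b k x * far i (k i))).
  apply: ler_sum => k _; rewrite -mulr_sumr ler_wpM2l//.
  have [dx|_] := leP d; last by apply: sumr_ge0 => i _; exact: ler0n.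
  have [i dxi] : exists i, d <= `|x 0 i - y 0 i - trig_node rho n (k i)|.
    apply: contrapT => /forallNP near; move: dx; rewrite leNgt => /negP; apply.
    by apply: rV_norm_lt => // i; rewrite !mxE opprD addrA ltNge; apply/negP/near.
  by rewrite (bigD1 i)//= /far dxi lerDl; apply: sumr_ge0 => j _; exact: ler0n.
rewrite exchange_big/=; apply: (@le_trans _ _ (\sum_(i < N) e / N.+1%:R)).
  apply: ler_sum => i _.
  rewrite (@sum_prod_marginal _ _ _ (fun j (m : 'I_n.+1) => bernstein (s j x) n m)).
    apply: (tail (x 0 i - y 0 i)); apply: le_trans xy.
    by have := coord_le_norm (x - y) i; rewrite !mxE.
  by move=> j; exact: bernstein_sum1.
by rewrite sumr_const card_ord -(mulr_natr (e / _)) mulrAC ler_pdivrMr// ler_pM2l// ler_nat.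
Qed.

End TrigPartition.

(** * Viscosity inequalities and the resolvent *)

Section Semicontinuity.
Variables (R : realType) (N : nat).
Notation pt := 'rV[R]_N.
Implicit Types (D : set pt) (u v g : pt -> R) (x : pt).

Lemma usc_onP D u : usc_on D u <->
  forall x, D x -> forall e : R, 0 < e -> \forall y \near x, D y -> u y < u x + e.
Proof.
split=> usc x Dx e e0.
  have [d d0 ud] := usc x Dx e e0; apply/nbhs_normP; exists d => //= y yx Dy.
  by apply: ud => //; rewrite distrC.
have /nbhs_normP[d /= d0 ud] := usc x Dx e e0; exists d => // y Dy yx.
by apply: ud => //=; rewrite distrC.
Qed.

Lemma lsc_on_usc_onN D v : lsc_on D v <-> usc_on D (fun x => - v x).
Proof.
by split=> sc x Dx e e0; have [d d0 vd] := sc x Dx e e0;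
  exists d => // y Dy yx; have := vd y Dy yx; lra.
Qed.

Lemma usc_onD D u v : usc_on D u -> usc_on D v -> usc_on D (fun x => u x + v x).
Proof.
move=> /usc_onP uu /usc_onP uv; apply/usc_onP => x Dx e e0.
have e2 : 0 < e / 2 by rewrite divr_gt0.
near=> y => Dy.
have : u y < u x + e / 2 by move: Dy; near: y; exact: uu.
have : v y < v x + e / 2 by move: Dy; near: y; exact: uv.
lra.
Unshelve. all: by end_near. Qed.

Lemma continuous_usc_on D u : continuous u -> usc_on D u.
Proof.
move=> cu; apply/usc_onP => x _ e e0; have /cvgr_lt/(_ (u x + e) _) := cu x.
by rewrite ltrDl => /(_ e0); apply: filterS.
Qed.

Lemma usc_onS D D' u : D' `<=` D -> usc_on D u -> usc_on D' u.
Proof.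
move=> DD uu x Dx e e0; have [d d0 ud] := uu x (DD _ Dx) e e0.
by exists d => // y Dy; apply: ud; exact: DD.
Qed.

Lemma usc_on_max D u : compact D -> D !=set0 -> usc_on D u ->
  exists2 x, D x & forall y, D y -> u y <= u x.
Proof.
move=> cD [x0 Dx0] /usc_onP uu.
pose F := filter_from D (fun x => [set y | D y /\ u x <= u y]).
have FF : ProperFilter F.
  apply: filter_from_proper; last by move=> x Dx; exists x.
  apply: filter_from_filter => [|x y Dx Dy]; first by exists x0.
  have [xy|/ltW yx] := leP (u x) (u y).
    by exists y => // z [Dz yz]; split; split=> //; exact: le_trans yz.
  by exists x => // z [Dz xz]; split; split=> //; exact: le_trans xz.
have FD : F D by exists x0 => // y [].
have [p [Dp clp]] := cD F FF FD; exists p => // x Dx; apply/ler_addgt0Pr => e e0.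
have Fx : F [set y | D y /\ u x <= u y] by exists x.
have [z [[Dz xz] /(_ Dz) zp]] := clp _ _ Fx (uu p Dp e e0).
by apply: le_trans xz _; exact: ltW.
Qed.

Lemma usc_on_interior_max (w : pt -> R) (x0 : pt) (r : R) : 0 < r ->
  usc_on (closed_ball x0 r) w -> (forall x, `|x - x0| = r -> w x < w x0) ->
  exists y, [/\ `|y - x0| < r, w x0 <= w y & \forall x \near y, w x <= w y].
Proof.
move=> r0 uw w_lt; have ball0 : closed_ball x0 r !=set0 by exists x0; exact: closed_ballxx.
have [y yr ymax] := usc_on_max (@compact_closed_ball _ _ x0 r r0) ball0 uw.
have wy := ymax _ (closed_ballxx r0); have {}yr : `|y - x0| < r.
  have /(closed_ballP _ _ r0) := yr; rewrite le_eqVlt => /predU1P[/w_lt|//].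
  by rewrite ltNge wy.
by exists y; split=> //; apply: filterS (near_closed_ball yr).
Qed.

Lemma usc_on_penalized_max (w : pt -> R) (x0 : pt) r : 0 < r -> usc_on (closed_ball x0 r) w ->
  exists x K, [/\ `|x - x0| < r, w x0 <= w x &
    \forall y \near x, w y - K * dotp (y - x0) (y - x0) <= w x - K * dotp (x - x0) (x - x0)].
Proof.
move=> r0 uw; have ball0 : closed_ball x0 r !=set0 by exists x0; exact: closed_ballxx.
have [xb _ wxb] := usc_on_max (@compact_closed_ball _ _ x0 r r0) ball0 uw.
have wb : w x0 <= w xb by apply: wxb; exact: closed_ballxx.
pose K := (w xb - w x0 + 1) / r ^+ 2; have K0 : 0 < K by rewrite divr_gt0 ?exprn_gt0//; lra.
have KE : K * r ^+ 2 = w xb - w x0 + 1 by rewrite divfK// gt_eqF// exprn_gt0.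
have upen : usc_on (closed_ball x0 r) (fun y => w y - K * dotp (y - x0) (y - x0)).
  apply: usc_onD => //; apply/continuous_usc_on => x.
  exact: (continuousN (is_hessian_continuous (is_hessianZ K (is_hessian_sqdist x0)) (x := x))).
have [x xr|x [xr]] := usc_on_interior_max r0 upen; rewrite subrr dotp0l mulr0 subr0.
  have := sqr_norm_le_dotpp (x - x0); rewrite xr -(ler_pM2l K0) KE.
  by have : w x <= w xb; [apply/wxb/closed_ballP => //; rewrite xr|lra].
have := mulr_ge0 (ltW K0) (dotpp_ge0 (x - x0)) => pen0 wx xmax.
by exists x, K; split=> //; lra.
Qed.

End Semicontinuity.

Section Lipschitz.
Variables (R : realType) (V : normedModType R).
Implicit Types (g : V -> R) (L : R).

Lemma klipschitzP L g : L.-lipschitz g <-> forall x y, `|g x - g y| <= L * `|x - y|.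
Proof. by split=> [gL x y|gL [x y] _]; [exact: (gL (x, y) (conj I I))|exact: gL]. Qed.

Lemma klipschitz_continuous L g : L.-lipschitz g -> continuous g.
Proof.
move=> /klipschitzP gL x; apply/(@cvgrPdist_le _ _ _ (nbhs x)) => e e0.
have L1 : 0 < `|L| + 1 by rewrite ltr_wpDl.
apply/nbhs_normP; exists (e / (`|L| + 1)) => [|y /=]; first exact: divr_gt0.
rewrite ltr_pdivlMr// => /ltW; apply: le_trans; apply: le_trans (gL _ _) _.
by rewrite mulrC ler_wpM2l// (le_trans (ler_norm _))// lerDl.
Qed.

End Lipschitz.

Section ViscosityHessian.
Variables (R : realType) (N : nat).
Notation pt := 'rV[R]_N.
Implicit Types (P : set 'M[R]_N) (U : set pt) (u g : pt -> R) (x y z : pt).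

(* [D^2 u \in P] on [U] in the viscosity sense, tested from above. *)
Definition visc_hessian_in P U u : Prop :=
  forall phi H x, is_hessian phi H -> U x ->
    (\forall y \near x, u y - phi y <= u x - phi x) -> P (H x).

Definition visc_ellop_ge m (S : 'M[R]_(m, N)) (c : R) : set pt -> (pt -> R) -> Prop :=
  visc_hessian_in [set K | c <= ellop S K].

Lemma visc_hessian_inW P P' U U' u : P `<=` P' -> U' `<=` U ->
  visc_hessian_in P U u -> visc_hessian_in P' U' u.
Proof. by move=> PP UU Pu phi H x phiH /UU Ux umax; exact/PP/(Pu phi). Qed.

Lemma visc_hessian_in_eq P U u g : open U -> (forall x, U x -> u x = g x) ->
  visc_hessian_in P U u -> visc_hessian_in P U g.
Proof.
move=> oU ug Pu phi H x phiH Ux gmax; apply: (Pu phi) => //.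
have : \forall y \near x, U y by exact: open_nbhs_nbhs.
by apply: filterS2 gmax => y gmax Uy; rewrite !ug.
Qed.

Lemma visc_hessian_in_shift P U u z : visc_hessian_in P U u ->
  visc_hessian_in P [set x | U (x + z)] (fun x => u (x + z)).
Proof.
move=> Pu phi H x phiH Ux umax; rewrite -[x](addrK z).
apply: (Pu _ _ _ (is_hessian_shift (- z) phiH)) => //; rewrite addrK.
have /nbhs_normP[r r0 umaxr] := umax; apply/nbhs_normP; exists r => // y /= xzy.
by have := umaxr (y - z); rewrite /= opprB addrA subrK; exact.
Qed.

Lemma visc_hessian_in_is_hessian P U u f K : is_hessian f K -> visc_hessian_in P U u ->
  visc_hessian_in [set A | exists2 x, U x & P (A + K x)] U (fun x => u x - f x).
Proof.
move=> fK Pu phi H x phiH Ux umax; exists x => //.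
apply: (Pu _ _ _ (is_hessianD phiH fK)) => //.
by apply: filterS umax => y; lra.
Qed.

Lemma is_hessian_visc_ellop_geN m (S : 'M[R]_(m, N)) (c : R) U f H : is_hessian f H ->
  (forall x, U x -> ellop S (H x) <= c) -> visc_ellop_ge S (- c) U (fun x => - f x).
Proof.
move=> fH Hc phi K x phiK Ux fmax.
have KH : psd (K x + H x).
  apply: (is_hessian_local_min_psd (is_hessianD phiK fH)).
  by apply: filterS fmax => y; lra.
by have := ellop_ge0 S KH; have := Hc x Ux; rewrite ellopD /=; lra.
Qed.

Lemma visc_hessian_in_le P y (r : R) u phi H : 0 < r ->
  usc_on (closed_ball y r) u -> visc_hessian_in P (ball y r) u -> is_hessian phi H ->
  (forall x, `|x - y| = r -> u x <= phi x) ->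
  (forall x, `|x - y| < r -> P (H x) -> u x <= phi x) -> u y <= phi y.
Proof.
move=> r0 uu Pu phiH bd_le in_le; rewrite leNgt; apply/negP => phiu.
have uphi : usc_on (closed_ball y r) (fun x => u x - phi x).
  apply: usc_onD => //; apply/continuous_usc_on => x.
  exact/continuousN/(is_hessian_continuous phiH).
have [x xr|x [xr x_ge xmax]] := usc_on_interior_max r0 uphi; first by have := bd_le x xr; lra.
have : u x <= phi x by apply: in_le => //; apply: (Pu phi) => //; rewrite -ball_normE /= distrC.
lra.
Qed.

End ViscosityHessian.

Section ResolventInequality.
Variables (R : realType) (m N : nat) (S : 'M[R]_(m, N)).
Notation pt := 'rV[R]_N.

Lemma quartic_supersolution (B K : R) : 0 <= B -> 0 <= K ->
  exists p : {poly R}, [/\ forall t : R, t ^+ 4 <= p.[t],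
    forall b t : R, 0 <= b <= B -> K * (b * p^`()^`().[t]) <= p.[t] &
    p.[0] = 24 * B ^+ 2 * K ^+ 2].
Proof.
move=> B0 K0; pose p : {poly R} := 'X^4 + (12 * B * K) *: 'X^2 + (24 * B ^+ 2 * K ^+ 2)%:P.
have pE t : p.[t] = t ^+ 4 + 12 * B * K * t ^+ 2 + 24 * B ^+ 2 * K ^+ 2.
  by rewrite /p !hornerE.
have ddpE t : p^`()^`().[t] = 12 * t ^+ 2 + 24 * B * K.
  by rewrite /p !(derivD, derivXn, derivZ, derivC, derivMn) !hornerE/=; ring.
exists p; split=> [t|b t /andP[_ bB]|]; last by rewrite pE; ring.
  rewrite pE; have := mulr_ge0 (mulr_ge0 B0 K0) (sqr_ge0 t).
  by have := mulr_ge0 (sqr_ge0 B) (sqr_ge0 K); lra.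
have {}bB : 0 <= B - b by rewrite subr_ge0.
have t4 : 0 <= t ^+ 4 by rewrite (exprM t 2 2) sqr_ge0.
have := mulr_ge0 (mulr_ge0 K0 bB) (sqr_ge0 t).
by have := mulr_ge0 (mulr_ge0 (sqr_ge0 K) B0) bB; rewrite pE ddpE; lra.
Qed.

Lemma resolvent_barrier (y : pt) (rho Q : R) : 0 < rho -> 0 <= Q ->
  exists C, forall k, exists psi H,
   [/\ is_hessian psi H, forall x, 0 <= psi x - k ^+ 2 * ellop S (H x),
       forall x, `|x - y| = rho -> Q <= psi x & psi y = C * k ^+ 4].
Proof.
move=> rho0 Q0; pose b i : R := ellop S ((ebasis R i)^T *m ebasis R i).
have b0 i : 0 <= b i by rewrite /b ellop_outer dotpp_ge0.
pose B := \sum_i b i; have B0 : 0 <= B by exact: sumr_ge0.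
have bB i : 0 <= b i <= B by rewrite b0/= /B (bigD1 i)//= lerDl sumr_ge0.
pose D := Q / rho ^+ 4; have D0 : 0 <= D by rewrite divr_ge0// exprn_ge0// ltW.
exists (D * (N%:R * (24 * B ^+ 2))) => k.
have [p [p_ge p_super p0]] := quartic_supersolution B0 (sqr_ge0 k).
pose l i (x : pt) := dotp x (ebasis R i) + (- y 0 i).
have lE i x : l i x = x 0 i - y 0 i by rewrite /l dotp_delta.
have pow4_ge0 (t : R) : 0 <= t ^+ 4 by rewrite (exprM t 2 2) sqr_ge0.
have p_ge0 t : 0 <= p.[t] := le_trans (pow4_ge0 t) (p_ge t).
exists (fun x => D * \sum_i p.[l i x]),
   (fun x => D *: \sum_i (p^`()^`().[l i x] *: ((ebasis R i)^T *m ebasis R i))); split.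
- by apply/is_hessianZ/is_hessian_sum => i; exact: is_hessian_ridge_poly.
- move=> x; rewrite ellopZ ellop_sum mulrCA -mulrBr mulr_ge0// mulr_sumr -sumrB.
  by apply: sumr_ge0 => i _; rewrite ellopZ subr_ge0 [_ * ellop _ _]mulrC; exact: p_super (bB i).
- move=> x xr; have [i xi] : exists i, rho <= `|x 0 i - y 0 i|.
    apply: contrapT => /forallNP lt; suff : `|x - y| < rho by rewrite xr ltxx.
    by apply: rV_norm_lt => // i; rewrite !mxE ltNge; apply/negP/lt.
  have {1}-> : Q = D * rho ^+ 4 by rewrite divfK// gt_eqF// exprn_gt0.
  rewrite ler_wpM2l// (bigD1 i)//= -[leLHS]addr0 lerD ?sumr_ge0//.
  apply: le_trans (p_ge _); rewrite lE -[leRHS]ger0_norm// normrX.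
  by rewrite lerXn2r ?nnegrE ?(ltW rho0).
- rewrite (eq_bigr (fun=> 24 * B ^+ 2 * (k ^+ 2) ^+ 2)) => [|i _]; last by rewrite lE subrr.
  by rewrite sumr_const card_ord -(mulr_natr (24 * _ * _)) -exprM; ring.
Qed.

Lemma partition_interpolation_le (K : finType) (b : K -> R) (node : K -> pt) (x : pt)
    (g : pt -> R) (M L d e : R) : (forall i, 0 <= b i) -> \sum_i b i = 1 ->
  \sum_i b i * (d <= `|x - node i|)%R%:R <= e -> 0 <= d -> 0 <= L ->
  (forall z, `|g z| <= M) -> L.-lipschitz g ->
  g x <= \sum_i g (node i) * b i + (L * d + 2 * M * e).
Proof.
move=> b0 b1 tail d0 L0 gM /klipschitzP gL; have M0 : 0 <= M by exact: le_trans (gM 0).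
have gnode i : g x - g (node i) <= L * d + 2 * M * (d <= `|x - node i|)%R%:R.
  have [dx|/ltW dx] := leP d.
    have := gM x; have := gM (node i); rewrite mulr1 !ler_norml.
    by have := mulr_ge0 L0 d0; lra.
  by rewrite mulr0 addr0 (le_trans (ler_norm _))// (le_trans (gL _ _))// ler_wpM2l.
rewrite -lerBlDl -[g x]mulr1 -b1 mulr_sumr -sumrB.
apply: (@le_trans _ _ (\sum_i (b i * (L * d) + 2 * M * (b i * (d <= `|x - node i|)%R%:R)))).
  apply: ler_sum => i _; rewrite -mulrBl (mulrC _ (b i)) (mulrCA (2 * M)) -mulrDr.
  exact: ler_wpM2l.
by rewrite big_split/= -mulr_suml b1 mul1r -mulr_sumr lerD2l ler_wpM2l// mulr_ge0.
Qed.

(* Approximate solutions [W] of [W - k^2 L W = g] near [y], whose value at [y] is a combination of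
   finitely many values of [g], with nodes and weights that do not depend on [g]. *)
Lemma approximate_resolvent (y : pt) (rho M L k s : R) : 0 < rho -> 0 <= M -> 0 <= L -> 0 < s ->
  exists (K : finType) (node : K -> pt) (om : K -> R), forall g,
    (forall x, `|g x| <= M) -> L.-lipschitz g -> exists W H,
      [/\ is_hessian W H, W y = \sum_i om i * g (node i), forall x, - M <= W x &
      forall x, `|x - y| <= rho -> g x <= W x - k ^+ 2 * ellop S (H x) + s].
Proof.
move=> rho0 M0 L0 s0.
have [L1 M1] : 0 < 2 * (L + 1) /\ 0 < 4 * (M + 1) by split; lra.
pose d := Num.min rho (s / (2 * (L + 1))).
have drho : 0 < d <= rho by rewrite lt_min rho0 divr_gt0//= ge_min lexx.
have [K [b [node [tb b0 b1 tail]]]] := trig_partition y drho (divr_gt0 s0 M1).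
have /choice[w /choice[H wH]] i := resolvent_trig S k (tb i).
exists K, node, (fun i => w i y) => g gM gL.
exists (fun x => \sum_i g (node i) * w i x), (fun x => \sum_i g (node i) *: H i x).
have WH : is_hessian (fun x => \sum_i g (node i) * w i x) (fun x => \sum_i g (node i) *: H i x).
  by apply: is_hessian_sum => i; apply: is_hessianZ; case: (wH i).
have WE x : (\sum_i g (node i) * w i x) - k ^+ 2 * ellop S (\sum_i g (node i) *: H i x) =
    \sum_i g (node i) * b i x.
  rewrite ellop_sum mulr_sumr -sumrB; apply: eq_bigr => i _.
  by rewrite ellopZ mulrCA -mulrBr; case: (wH i) => _ -> _.
split=> //.
- by apply: eq_bigr => i _; rewrite mulrC.
- apply: (resolvent_ge WH (S := S) (k := k)) => [|x].
    have /choice[B wB] i : exists C, forall x, `|w i x| <= C by case: (wH i).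
    exists (\sum_i `|g (node i)| * B i) => x; apply: le_trans (ler_norm_sum _ _ _) _.
    by apply: ler_sum => i _; rewrite normrM ler_wpM2l.
  rewrite WE -[leLHS]mulr1 -(b1 x) mulr_sumr; apply: ler_sum => i _.
  by rewrite ler_wpM2r//; have := gM (node i); rewrite ler_norml => /andP[].
move=> x xy; rewrite WE.
apply: le_trans (partition_interpolation_le (b0^~ x) (b1 x) (tail x xy) _ L0 gM gL) _.
  by case/andP: drho => /ltW.
rewrite lerD2l [leRHS]splitr lerD//.
  have : d <= s / (2 * (L + 1)) by rewrite ge_min lexx orbT.
  by rewrite ler_pdivlMr//; case/andP: drho; lra.
by rewrite mulrA ler_pdivrMr//; have := mulr_ge0 M0 (ltW s0); lra.
Qed.

Lemma resolvent_inequality (y : pt) (rho M L c0 : R) : 0 < rho -> 0 <= M -> 0 <= L -> 0 <= c0 ->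
  exists C, forall k s, 0 <= k <= 1 -> 0 < s ->
    exists (K : finType) (node : K -> pt) (om : K -> R),
      forall g c, `|c| <= c0 -> (forall x, `|g x| <= M) -> L.-lipschitz g ->
        visc_ellop_ge S c (ball y rho) g ->
        g y <= \sum_i om i * g (node i) + s - k ^+ 2 * c + C * k ^+ 4.
Proof.
move=> rho0 M0 L0 c00; have Q0 : 0 <= 2 * M + c0 by rewrite addr_ge0// mulr_ge0.
have [C barrier] := resolvent_barrier y rho0 Q0; exists C => k s /andP[k0 k1] s0.
have [psi [Hpsi [psiH psi_super psi_bd psiy]]] := barrier k.
have [K [node [om approx]]] := approximate_resolvent y k rho0 M0 L0 s0.
exists K, node, om => g c cc0 gM gL gvisc.
have [W [HW [WH Wy WM gW]]] := approx g gM gL.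
have phiH : is_hessian (fun x => W x + psi x + (s - k ^+ 2 * c)) (fun x => HW x + Hpsi x).
  exact/is_hessian_addr/is_hessianD.
rewrite -Wy -psiy; have -> : W y + s - k ^+ 2 * c + psi y = W y + psi y + (s - k ^+ 2 * c) by ring.
have k2 := sqr_ge0 k.
apply: (visc_hessian_in_le rho0 _ gvisc phiH) => [|x xr|x xr /= cH].
- exact/continuous_usc_on/klipschitz_continuous/gL.
- have kc : k ^+ 2 * c <= c0.
    rewrite (le_trans (ler_norm _))// normrM ger0_norm//.
    by apply: le_trans (_ : `|c| <= c0) => //; rewrite ler_piMl// expr_le1.
  by have := psi_bd x xr; have := WM x; have := gM x; rewrite ler_norml => /andP[_]; lra.
- have := gW x (ltW xr); have := psi_super x; have := ler_wpM2l k2 cH.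
  by rewrite ellopD mulrDr; lra.
Qed.

End ResolventInequality.

(** * Averages over segments *)

Section SegmentAverage.
Variables (R : realType) (V : normedModType R).
Implicit Types (g : V -> R) (x v w z : V) (L M c : R).

Definition avg v g x : R := \int[lebesgue_measure]_(t in `[0, 1]) g (x + t *: v).

Lemma antiderivative (f : R -> R) (a b : R) : continuous f ->
  exists F : R -> R, forall t : R, a < t < b -> is_derive t 1 F (f t).
Proof.
move=> cf; pose F (s : R) := \int[lebesgue_measure]_(t in [set` Interval (BLeft a) (BRight s)]) f t.
exists F => t /andP[a_lt t_lt].
have intf : lebesgue_measure.-integrable [set` Interval (BLeft a) (BRight b)] (EFin \o f).
  by apply: continuous_compact_integrable; [exact: segment_compact|exact: continuous_subspaceT].
have [|d dE] := continuous_FTC1 t_lt intf _ (cf t); first by rewrite /= lte_fin.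
by split; [exact: d|rewrite -derive1E; exact: dE].
Qed.

Lemma continuous_line g x v : continuous g -> continuous (fun t : R => g (x + t *: v)).
Proof.
move=> cg t; apply: (@continuous_comp _ _ _ (fun t : R => x + t *: v) g); last exact: cg.
by apply: continuousD; [exact: cst_continuous|exact: scalel_continuous].
Qed.

Lemma integrable_line g x v : continuous g ->
  lebesgue_measure.-integrable `[0, 1]%classic (EFin \o (fun t : R => g (x + t *: v))).
Proof.
move=> cg; apply: continuous_compact_integrable; first exact: segment_compact.
exact/continuous_subspaceT/continuous_line.
Qed.

Lemma avgD v g g' x : continuous g -> continuous g' ->
  avg v (fun y => g y + g' y) x = avg v g x + avg v g' x.
Proof. by move=> cg cg'; rewrite /avg RintegralD//; exact: integrable_line. Qed.

Lemma avgZ v c g x : continuous g -> avg v (fun y => c * g y) x = c * avg v g x.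
Proof. by move=> cg; rewrite /avg RintegralZl//; exact: integrable_line. Qed.

Lemma avgB v g g' x : continuous g -> continuous g' ->
  avg v (fun y => g y - g' y) x = avg v g x - avg v g' x.
Proof. by move=> cg cg'; rewrite /avg RintegralB//; exact: integrable_line. Qed.

Lemma avg_cst v c x : avg v (fun=> c) x = c.
Proof.
by rewrite /avg Rintegral_cst//= lebesgue_measure_itv/= lte_fin ltr01 oppr0 adde0 mulr1.
Qed.

Lemma avg_shift v g z x : avg v (fun y => g (y + z)) x = avg v g (x + z).
Proof. by apply: eq_Rintegral => t _; rewrite addrAC. Qed.

Lemma avg_sum (I : Type) (r : seq I) v (g : I -> V -> R) x : (forall i, continuous (g i)) ->
  avg v (fun y => \sum_(i <- r) g i y) x = \sum_(i <- r) avg v (g i) x.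
Proof.
move=> cg; elim: r => [|i r IH].
  by under eq_fun do rewrite big_nil; rewrite avg_cst big_nil.
under eq_fun do rewrite big_cons; rewrite big_cons avgD ?IH//.
exact: continuous_sum.
Qed.

Lemma le_avg v g g' x : continuous g -> continuous g' ->
  (forall t, 0 <= t <= 1 -> g (x + t *: v) <= g' (x + t *: v)) -> avg v g x <= avg v g' x.
Proof. by move=> cg cg' gg'; apply: le_Rintegral => //; exact: integrable_line. Qed.

Lemma norm_avg_le v g x M : continuous g ->
  (forall t, 0 <= t <= 1 -> `|g (x + t *: v)| <= M) -> `|avg v g x| <= M.
Proof.
have cM c : continuous (fun _ : V => c) by move=> y; exact: cst_continuous.
move=> cg gM; rewrite ler_norml -{1}(avg_cst v (- M) x) -{2}(avg_cst v M x).
by apply/andP; split; apply: le_avg => // t /gM; rewrite ler_norml => /andP[].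
Qed.

Lemma avg_near v g x L : L.-lipschitz g -> `|avg v g x - g x| <= L * `|v|.
Proof.
move=> gL; have cg := klipschitz_continuous gL; move/klipschitzP: gL => gL.
have cx : continuous (fun _ : V => g x) by move=> y; exact: cst_continuous.
rewrite -[X in _ - X](avg_cst v _ x) -avgB//; apply: norm_avg_le => [y|t /andP[t0 t1]].
  by apply: continuousB; [exact: cg|exact: cx].
apply: le_trans (gL _ _) _; rewrite addrAC subrr add0r normrZ ger0_norm//.
have L0 : 0 <= L * `|v|.
  by have := gL (x + v) x; rewrite addrAC subrr add0r; exact: le_trans.
by rewrite mulrCA ler_piMl.
Qed.

Lemma avg_lipschitz v g L : L.-lipschitz g -> L.-lipschitz (avg v g).
Proof.
move=> gL; have cg := klipschitz_continuous gL; move/klipschitzP: gL => gL.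
apply/klipschitzP => x y; have -> : avg v g y = avg v (fun z => g (z + (y - x))) x.
  by rewrite avg_shift addrCA subrr addr0.
have cs := continuous_shift (z := y - x) cg.
rewrite -avgB//; apply: norm_avg_le => [z|t _].
  by apply: continuousB; [exact: cg|exact: cs].
by apply: le_trans (gL _ _) _; rewrite opprD addrA subrr sub0r opprB.
Qed.

Lemma avg_antiderivative v g x (F : R -> R) : continuous g ->
  (forall t : R, 0 <= t <= 1 -> is_derive t 1 F (g (x + t *: v))) -> avg v g x = F 1 - F 0.
Proof.
move=> cg dF; have cF (t : R) : 0 <= t <= 1 -> {for t, continuous F}.
  by move=> /dF[dFt _]; apply: differentiable_continuous; exact/derivable1_diffP.
rewrite /avg /Rintegral (continuous_FTC2 (F := F))//.
- exact/continuous_subspaceT/continuous_line.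
- split.
  + by move=> t; rewrite in_itv/= => /andP[t0 t1]; have [] := dF t; rewrite ?ltW.
  + by apply: cvg_at_right_filter; apply: cF; rewrite lexx ler01.
  + by apply: cvg_at_left_filter; apply: cF; rewrite lexx ler01.
- move=> t; rewrite in_itv/= derive1E => /andP[t0 t1].
  by have [|_ ->] := dF t; rewrite ?ltW.
Qed.

Definition increment v g x : R := g (x + v) - g x.

Lemma increment_lipschitz v g L : L.-lipschitz g -> (2 * L).-lipschitz (increment v g).
Proof.
move=> /klipschitzP gL; apply/klipschitzP => x y; rewrite /increment.
have gLv := gL (x + v) (y + v); rewrite opprD addrACA subrr addr0 in gLv.
rewrite (_ : _ - _ = (g (x + v) - g (y + v)) - (g x - g y)); last by ring.
by apply: le_trans (ler_normB _ _) _; have := gL x y; lra.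
Qed.

Lemma avg_increment v w g x : continuous g ->
  avg v (increment w g) x = increment w (avg v g) x.
Proof.
by move=> cg; rewrite /increment -avg_shift -avgB//; exact: continuous_shift.
Qed.

Lemma is_derive_avg v g x : continuous g -> is_derive x v (avg v g) (increment v g x).
Proof.
move=> cg; have [F dF] := antiderivative (-1) 2 (@continuous_line g x v cg).
have avgF (h : R) : `|h| < 1 -> avg v g (x + h *: v) = F (1 + h) - F h.
  rewrite ltr_norml => /andP[hN1 h1]; rewrite -[in F h](add0r h).
  apply: (avg_antiderivative (F := fun t => F (t + h)) cg) => t /andP[t0 t1].
  apply: is_derive_shift; rewrite -addrA -scalerDl (addrC h).
  by apply: dF; apply/andP; split; lra.
have [d0 d1] : is_derive (0 : R) 1 F (g x) /\ is_derive (1 : R) 1 F (g (x + v)).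
  split.
    by rewrite -[x in g x]addr0 -(scale0r v); apply: dF; apply/andP; split; lra.
  by rewrite -(scale1r v); apply: dF; apply/andP; split; lra.
have dFF : is_derive (0 : R) 1 (fun h => F (1 + h) - F h) (increment v g x).
  apply: is_deriveB d0; under eq_fun do rewrite addrC.
  by apply: is_derive_shift; rewrite add0r.
apply/is_deriveP => e /((@is_deriveP R R^o _ _ _ _).1 dFF) dFFe.
have small : \forall h \near (0 : R), `|h| < 1.
  by apply/nbhs_normP; exists 1 => //= h /=; rewrite sub0r normrN.
apply: filterS2 small dFFe => h h1; rewrite [h *: (1 : R^o)]mulr1 add0r addr0.
by rewrite avgF// -{2}[x]addr0 -(scale0r v) avgF ?normr0// addr0.
Qed.

Lemma is_derive_avg_under v w g g' L x : continuous g -> L.-lipschitz g' ->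
  (forall y, is_derive y w g (g' y)) -> is_derive x w (avg v g) (avg v g' x).
Proof.
move=> cg gL dg; have cg' := klipschitz_continuous gL; move/klipschitzP: gL => gL.
apply/is_deriveP => e e0; have K1 : 0 < `|L| * `|w| + 1 by rewrite ltr_wpDl// mulr_ge0.
apply/nbhs_normP; exists (e / (`|L| * `|w| + 1)) => [|h] /=; first by rewrite divr_gt0.
rewrite sub0r normrN ltr_pdivlMr// => hK.
have cs := continuous_shift (z := h *: w) cg.
have ci : continuous (fun y => g (y + h *: w) - g y).
  by move=> y; apply: continuousB; [exact: cs|exact: cg].
have ch : continuous (fun y => h * g' y) by exact: continuous_cstM.
rewrite -avg_shift -avgB// -avgZ// -avgB//; apply: norm_avg_le => [y|t _].
  exact: (continuousB (ci y) (ch y)).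
have dgh y : is_derive y (h *: w) g (h * g' y) by exact: is_derive_scaler.
have [s /andP[s0 s1] ->] := mean_value_line (x + t *: v) dgh.
rewrite -mulrBr normrM mulrC ler_wpM2r//; apply: le_trans (gL _ _) _.
rewrite addrAC subrr add0r !normrZ ger0_norm//.
have hw0 : 0 <= `|h| * `|w| by exact: mulr_ge0.
apply: (@le_trans _ _ (`|L| * (`|h| * `|w|))).
  apply: le_trans (ler_wpM2r _ (ler_norm L)) _; first by rewrite mulr_ge0.
  by rewrite ler_wpM2l// ler_piMl.
by apply: le_trans (ltW hK); rewrite mulrCA ler_wpM2l// lerDl.
Qed.

Lemma avg_translate_le (K : finType) (node : K -> V) (om : K -> R) v g y c : continuous g ->
  (forall t, 0 <= t <= 1 -> g (y + t *: v) <= \sum_i om i * g (node i + t *: v) + c) ->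
  avg v g y <= \sum_i om i * avg v g (node i) + c.
Proof.
move=> cg gle; have cs i : continuous (fun x => g (x + (node i - y))) by exact: continuous_shift.
have co i : continuous (fun x => om i * g (x + (node i - y))) by exact: continuous_cstM.
have csum : continuous (fun x => \sum_i om i * g (x + (node i - y))) by exact: continuous_sum.
have cc : continuous (fun _ : V => c) by move=> x; exact: cst_continuous.
have -> : \sum_i om i * avg v g (node i) + c =
    avg v (fun x => \sum_i om i * g (x + (node i - y)) + c) y.
  rewrite avgD// avg_cst avg_sum//; congr (_ + _); apply: eq_bigr => i _.
  by rewrite avgZ// avg_shift addrCA subrr addr0.
apply: le_avg => // [x|t /gle]; first exact: (continuousD (csum x) (cc x)).
by congr (_ <= _ + _); apply: eq_bigr => i _; rewrite addrAC addrCA subrr addr0.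
Qed.

Definition avgs (s : seq V) g : V -> R := foldr avg g s.

Lemma avgs_lipschitz s g L : L.-lipschitz g -> L.-lipschitz (avgs s g).
Proof. by move=> gL; elim: s => //= v s IH; exact: avg_lipschitz. Qed.

Lemma avgs_continuous s g L : L.-lipschitz g -> continuous (avgs s g).
Proof. by move=> gL; exact/klipschitz_continuous/avgs_lipschitz/gL. Qed.

Lemma norm_avgs_le s g M L x : L.-lipschitz g -> (forall y, `|g y| <= M) -> `|avgs s g x| <= M.
Proof.
move=> gL gM; elim: s x => //= v s IH x; apply: norm_avg_le => //.
exact: avgs_continuous gL.
Qed.

Lemma avgs_near s g L x : L.-lipschitz g -> `|avgs s g x - g x| <= L * \sum_(v <- s) `|v|.
Proof.
move=> gL; elim: s => /= [|v s IH]; first by rewrite subrr normr0 big_nil mulr0.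
rewrite big_cons mulrDr -[_ - _](subrKA (avgs s g x)).
apply: le_trans (ler_normD _ _) (lerD _ IH); exact/avg_near/avgs_lipschitz.
Qed.

Lemma avgs_translate_le (K : finType) s (node : K -> V) (om : K -> R) g y c L :
  L.-lipschitz g ->
  (forall z, `|z| <= \sum_(v <- s) `|v| -> g (y + z) <= \sum_i om i * g (node i + z) + c) ->
  avgs s g y <= \sum_i om i * avgs s g (node i) + c.
Proof.
move=> gL; elim: s y node => [|v s IH] y node gle /=.
  have := gle 0; rewrite big_nil normr0 addr0 => /(_ (lexx _)).
  by under [X in _ <= X + c -> _]eq_bigr do rewrite addr0.
apply: avg_translate_le => [|t /andP[t0 t1]]; first exact: avgs_continuous gL.
apply: IH => z zs; under eq_bigr do rewrite -addrA; rewrite -addrA; apply: gle.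
rewrite big_cons; apply: le_trans (ler_normD _ _) (lerD _ zs).
by rewrite normrZ ger0_norm// ler_piMl.
Qed.

Lemma is_derive_avgs s v g L x : v \in s -> L.-lipschitz g ->
  is_derive x v (avgs s g) (increment v (avgs (rem v s) g) x).
Proof.
move=> + gL; elim: s x => //= w s IH x; rewrite in_cons eq_sym.
have [-> _|wv /= vs] := eqVneq w v; first exact/is_derive_avg/avgs_continuous/gL.
rewrite -avg_increment; last exact: avgs_continuous gL.
apply: is_derive_avg_under => [||y]; last exact: IH.
- exact: avgs_continuous gL.
- exact/increment_lipschitz/avgs_lipschitz/gL.
Qed.

End SegmentAverage.

Section RemSeq.
Variable T : eqType.
Implicit Types (a b : T) (s : seq T).

Lemma remC a b s : rem a (rem b s) = rem b (rem a s).
Proof.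
elim: s => //= c s IH; have [cb|cb] := eqVneq c b; have [ca|ca] := eqVneq c a => //=.
- by rewrite -cb -ca.
- by rewrite cb eqxx.
- by rewrite ca eqxx.
- by rewrite (negbTE cb) (negbTE ca) IH.
Qed.

Lemma mem_rem_cat a b s s' : b \in s -> a \in s' -> a \in rem b (s ++ s').
Proof.
move=> + as'; elim: s => //= c s IH; rewrite in_cons eq_sym.
have [_ _|_ /= bs] := eqVneq c b; first by rewrite mem_cat as' orbT.
by rewrite in_cons IH ?orbT.
Qed.

End RemSeq.

Section Smoothing.
Variables (R : realType) (N : nat).
Notation pt := 'rV[R]_N.
Implicit Types (g : pt -> R) (x : pt) (L eps : R).

Definition basis_steps eps : seq pt := [seq (eps *: ebasis R i : pt) | i : 'I_N].

(* Two averages in each coordinate direction, one for each derivative. *)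
Definition smoothing_steps eps : seq pt := basis_steps eps ++ basis_steps eps.

Definition smoothing eps g : pt -> R := avgs (smoothing_steps eps) g.

Lemma norm_ebasis (i : 'I_N) : `|ebasis R i| <= 1.
Proof.
apply: rV_norm_le => // j; rewrite mxE eqxx/=.
by case: (j == i); rewrite ?normr1 ?normr0.
Qed.

Lemma sum_norm_smoothing_steps eps :
  \sum_(v <- smoothing_steps eps) `|v| <= (N + N)%:R * `|eps|.
Proof.
rewrite big_cat/= natrD mulrDl big_image/=.
by apply: lerD; rewrite -[X in X%:R]card_ord mulr_natl -sumr_const; apply: ler_sum => i _;
  rewrite normrZ ler_piMr// norm_ebasis.
Qed.

Lemma is_hessian_smoothing eps g L : eps != 0 -> L.-lipschitz g ->
  exists2 H, is_hessian (smoothing eps g) H & forall x, symmetric_mx (H x).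
Proof.
move=> eps0 gL; pose e (i : 'I_N) : pt := eps *: ebasis R i; pose s := smoothing_steps eps.
have es i : e i \in basis_steps eps by apply: map_f; rewrite mem_enum.
have ess i : e i \in s by rewrite mem_cat es.
have derive_ebasis f f' x i :
    is_derive x (e i) f (f' x) -> is_derive x (ebasis R i) f (eps^-1 * f' x).
  by move=> /(is_derive_scaler eps^-1); rewrite scalerA mulVf// scale1r.
pose A i := avgs (rem (e i) s) g; pose A2 i j := avgs (rem (e i) (rem (e j) s)) g.
pose D i j x := eps^-1 * (eps^-1 * increment (e j) (increment (e i) (A2 i j)) x).
exists (fun x => \matrix_(i, j) D i j x) => [|x].
  exists (fun j x => eps^-1 * increment (e j) (A j) x); split.
  - exact: avgs_continuous gL.
  - by move=> i; exact/continuous_cstM/klipschitz_continuous/increment_lipschitz/avgs_lipschitz/gL.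
  - move=> i j; under eq_fun do rewrite mxE; do 2 apply: continuous_cstM.
    exact/klipschitz_continuous/increment_lipschitz/increment_lipschitz/avgs_lipschitz/gL.
  - by move=> x i; apply: derive_ebasis; exact: is_derive_avgs gL.
  - move=> x i j; rewrite mxE; apply/is_deriveZ/derive_ebasis.
    have dA z : is_derive z (e i) (A j) (increment (e i) (A2 i j) z).
      by apply: is_derive_avgs gL; exact: mem_rem_cat.
    exact: is_deriveB (is_derive_shift (dA _)) (dA x).
apply/matrixP => i j; rewrite !mxE /D /A2 remC /increment.
by rewrite [x + _ + _]addrAC; ring.
Qed.

End Smoothing.

(** * Smooth approximation of viscosity subsolutions *)

Section AveragesPreserveSubsolutions.
Variables (R : realType) (m N : nat) (S : 'M[R]_(m, N)).
Notation pt := 'rV[R]_N.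

(* The inequalities of [resolvent_inequality] for [f], and for [- f] where [L f <= c'], add up to
   [k^2 (c - c') <= 2 s + 2 C k^4]. *)
Lemma ellop_ge_of_linear_inequalities (y : pt) (r c M L : R) (f : pt -> R) H :
  0 < r -> 0 <= L -> is_hessian f H -> (forall x, `|f x| <= M) -> L.-lipschitz f ->
  (forall (K : finType) (node : K -> pt) (om : K -> R) (a : R),
    (forall g, (forall x, `|g x| <= M) -> L.-lipschitz g -> visc_ellop_ge S c (ball y r) g ->
       g y <= \sum_i om i * g (node i) + a) ->
    f y <= \sum_i om i * f (node i) + a) ->
  c <= ellop S (H y).
Proof.
move=> r0 L0 fH fM fL ineq; rewrite leNgt; apply/negP => Hc.
pose c' := (ellop S (H y) + c) / 2; pose D := c - c'.
have D0 : 0 < D by rewrite /D /c'; lra.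
have /nbhs_ballP[rho /= rho0 Hc'] : \forall x \near y, ball y r x /\ ellop S (H x) <= c'.
  apply: filterI; first exact: nbhsx_ballx.
  have cH : continuous (fun x => ellop S (H x)) by apply: continuous_ellop; case: fH => G [].
  by have /cvgr_le := cH y; apply; rewrite /c'; lra.
have M0 : 0 <= M by exact: le_trans (fM 0).
have c00 : 0 <= `|c| + `|c'| by rewrite addr_ge0.
have [C resolvent] := resolvent_inequality S y rho0 M0 L0 c00.
have C1 : 0 < 8 * (`|C| + 1) by rewrite mulr_gt0// ltr_wpDl.
pose k := Num.min 1 (D / (8 * (`|C| + 1))).
have k0 : 0 < k by rewrite lt_min ltr01 divr_gt0.
have k1 : k <= 1 by rewrite ge_min lexx.
have kD : k * (8 * (`|C| + 1)) <= D by rewrite -ler_pdivlMr// ge_min lexx orbT.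
have kk0 : 0 < k ^+ 2 by rewrite exprn_gt0.
have s0 : 0 < k ^+ 2 * D / 8 by rewrite divr_gt0// mulr_gt0.
have [|K [node [om bound]]] := resolvent k _ _ s0; first by rewrite (ltW k0).
have f_le : f y <= \sum_i om i * f (node i) + (k ^+ 2 * D / 8 - k ^+ 2 * c + C * k ^+ 4).
  apply: ineq => g gM gL gvisc; rewrite !addrA; apply: bound => //; first by rewrite lerDl.
  by apply: visc_hessian_inW gvisc => // x /Hc'[].
have fN_le : - f y <= \sum_i om i * - f (node i) + k ^+ 2 * D / 8 - k ^+ 2 * (- c') + C * k ^+ 4.
  apply: (bound (fun x => - f x)) => [|x||]; rewrite ?normrN ?lerDr//.
    by apply/klipschitzP => x x'; rewrite -opprD normrN; move/klipschitzP: fL.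
  by apply: is_hessian_visc_ellop_geN fH _ => x /Hc'[].
have sumN : \sum_i om i * - f (node i) = - (\sum_i om i * f (node i)).
  by rewrite -sumrN; apply: eq_bigr => i _; rewrite mulrN.
have Ck : C * k ^+ 4 <= k ^+ 2 * (D / 8).
  rewrite (_ : k ^+ 4 = k ^+ 2 * (k * k)); last by ring.
  rewrite mulrCA ler_pM2l//; apply: (@le_trans _ _ (`|C| * k)); last by lra.
  apply: le_trans (ler_wpM2r _ (ler_norm C)) _; first by rewrite mulr_ge0// ltW.
  by rewrite ler_wpM2l// ler_piMl// ltW.
have := mulr_gt0 kk0 D0; rewrite {1}/D mulrBr => kDE; rewrite sumN in fN_le.
by rewrite /D in f_le fN_le Ck *; lra.
Qed.

Lemma visc_ellop_ge_avgs (y : pt) (r c M L : R) (g : pt -> R) s H :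
  0 <= L -> (forall x, `|g x| <= M) -> L.-lipschitz g -> visc_ellop_ge S c (ball y r) g ->
  \sum_(v <- s) `|v| < r -> is_hessian (avgs s g) H -> c <= ellop S (H y).
Proof.
move=> L0 gM gL gvisc sr avgH; pose d := \sum_(v <- s) `|v|.
have rd0 : 0 < r - d by rewrite subr_gt0.
apply: (ellop_ge_of_linear_inequalities rd0 L0 avgH) => [x||K node om a ineq].
- exact: norm_avgs_le gL gM.
- exact: avgs_lipschitz.
apply: avgs_translate_le (gL) _ => z zd; apply: (ineq (fun x => g (x + z))) => [//||].
  apply/klipschitzP => x x'; have := (klipschitzP L g).1 gL (x + z) (x' + z).
  by rewrite opprD addrACA subrr addr0.
apply: visc_hessian_inW (visc_hessian_in_shift (z := z) gvisc) => // x.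
rewrite -!ball_normE /= => yx; rewrite opprD addrA (le_lt_trans (ler_normB _ _))//.
by move: yx zd; rewrite /d; lra.
Qed.

End AveragesPreserveSubsolutions.

Definition det_superlevel (R : realType) N (q : R) : set 'M[R]_N :=
  [set K | [/\ symmetric_mx K, psd K & q <= \det K]].

Section DeterminantDuality.
Variables (R : realType) (N : nat).
Hypothesis N0 : (0 < N)%N.

Lemma trace_ge_of_det_ge1 (K : 'M[R]_N) : symmetric_mx K -> psd K -> 1 <= \det K ->
  N%:R <= \tr K.
Proof.
move=> sK pK dK; have N0R : 0 < N%:R :> R by rewrite ltr0n.
rewrite -(@ler_pXn2r _ N)// ?nnegrE ?(ltW N0R)//; last exact: psd_trace_ge0.
apply: le_trans (psd_det_le_trace N0 sK pK).
by rewrite ler_peMr// exprn_ge0// ltW.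
Qed.

Lemma ellop_scalar_gt0 (S : 'M[R]_N) (e : R) : \det S != 0 -> 0 < e -> 0 < ellop S e%:M.
Proof.
move=> dS e0; have pe : psd (e%:M : 'M[R]_N) by apply: psd_scalar; exact: ltW.
rewrite lt_neqAle ellop_ge0// andbT eq_sym; apply/eqP => tr0.
have := psd_det_le_trace N0 (symmx_congr S (symmx_scalar N e)) (psd_congr S pe).
rewrite -/(ellop S _) tr0 expr0n gtn_eqF//= det_congr det_scalar leNgt => /negP; apply.
have dS2 : 0 < \det S ^+ 2 by rewrite exprn_even_gt0.
apply: mulr_gt0; first by rewrite exprn_gt0// ltr0n.
exact: mulr_gt0 dS2 (exprn_gt0 N e0).
Qed.

(* The matrix arithmetic-geometric inequality [N (det B det K)^(1/N) <= tr (B K)], which is an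
   equality for [B] proportional to the inverse of [K]. *)
Lemma det_superlevel_of_ellop (q : R) (H : 'M[R]_N) : symmetric_mx H ->
  (forall m (S : 'M[R]_(m, N)) c, @det_superlevel R N q `<=` [set K | c <= ellop S K] ->
     c <= ellop S H) ->
  det_superlevel q H.
Proof.
move=> sH dual.
have pH : psd H.
  apply/psdP => x; have := dual 1%N x 0; rewrite /ellop /mxtrace big_ord1; apply => K [_ pK _].
  by rewrite /= big_ord1; exact: pK.
split=> //; rewrite -[H in leRHS]addr0 -(raddf0 (@scalar_mx R N)).
have cdet : \det (H + e%:M) @[e --> 0^'+] --> \det (H + 0%:M).
  apply: cvg_at_right_filter; under eq_fun do rewrite det_addscalarE.
  rewrite det_addscalarE; exact: continuous_horner.
apply: cvgr_to_ge cdet _; near=> e; have e0 : 0 < e by [].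
rewrite leNgt; apply/negP => dHe.
have sHe := symmxD sH (symmx_scalar N e).
have pHe : psd (H + e%:M) by apply: psdD pH _; apply: psd_scalar; exact: ltW.
have dHe0 : 0 < \det (H + e%:M).
  have := psd_det_superadd N0 sH (symmx_scalar N e) pH (psd_scalar (ltW e0)).
  by rewrite det_scalar; have := psd_det_ge0 sH pH; have := exprn_gt0 N e0; lra.
have [S SE] := psd_congr_id sHe pHe (lt0r_neq0 dHe0).
have detS : \det S ^+ 2 * \det (H + e%:M) = 1 by rewrite -det_congr SE det1.
have dS : \det S != 0.
  by apply: contra_eq_neq detS => ->; rewrite expr0n mul0r eq_sym oner_eq0.
have : N%:R <= ellop S H.
  apply: dual => K [sK pK qK]; apply: trace_ge_of_det_ge1; rewrite ?det_congr -?detS.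
  - exact: symmx_congr.
  - exact: psd_congr.
  - by rewrite ler_wpM2l ?sqr_ge0// (le_trans (ltW dHe)).
have : ellop S (H + e%:M) = N%:R by rewrite /ellop SE mxtrace1.
by rewrite ellopD; have := ellop_scalar_gt0 dS e0; lra.
Unshelve. all: by end_near. Qed.

End DeterminantDuality.

Section SmoothApproximation.
Variables (R : realType) (N : nat).
Hypothesis N0 : (0 < N)%N.
Notation pt := 'rV[R]_N.

Lemma det_superlevel_smooth_approx (x0 : pt) (r q M L eta : R) (g : pt -> R) :
  0 < r -> 0 <= L -> 0 < eta -> (forall x, `|g x| <= M) -> L.-lipschitz g ->
  visc_hessian_in (@det_superlevel R N q) (ball x0 r) g ->
  exists f H, [/\ is_hessian f H, forall x, `|f x - g x| <= eta &
    forall y, `|y - x0| <= r / 2 -> det_superlevel q (H y)].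
Proof.
move=> r0 L0 eta0 gM gL gvisc.
pose d := Num.min (r / 2) (eta / (L + 1)).
have L1 : 0 < L + 1 by rewrite ltr_wpDl.
have d0 : 0 < d by rewrite lt_min !divr_gt0.
pose eps := d / (N + N).+1%:R; have eps0 : 0 < eps by rewrite divr_gt0.
have steps_d : \sum_(v <- smoothing_steps N eps) `|v| < d.
  apply: le_lt_trans (sum_norm_smoothing_steps _ _) _.
  by rewrite gtr0_norm// mulrA ltr_pdivrMr// mulrC ltr_pM2l// ltr_nat.
have [H smoothH sH] := is_hessian_smoothing (lt0r_neq0 eps0) gL.
exists (smoothing eps g), H; split=> // [x|y yx0].
  apply: le_trans (avgs_near _ x gL) _.
  have dL : d * (L + 1) <= eta by rewrite -ler_pdivlMr// ge_min lexx orbT.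
  have := ler_wpM2l L0 (ltW steps_d); lra.
apply: det_superlevel_of_ellop => // m S c qc.
apply: (visc_ellop_ge_avgs L0 gM gL _ _ smoothH (r := r / 2)).
  apply: visc_hessian_inW gvisc => // x; rewrite -!ball_normE /= => yx.
  have := ler_distD y x x0; rewrite (distrC x y) (distrC x0 x); lra.
by rewrite (lt_le_trans steps_d)// ge_min lexx.
Qed.

End SmoothApproximation.

(** * Convexity and regularity of subsolutions *)

Section ChordTube.
Variables (R : realType) (N : nat).
Notation pt := 'rV[R]_N.
Variables a d : pt.
Hypothesis d0 : d != 0.
Implicit Types (x : pt) (e s : R).

Let xi : pt := (dotp d d)^-1 *: d.

Definition chord_coord x : R := dotp x xi + (- dotp a xi).
Definition chord_sqdist x : R := dotp (x - a) (x - a) - dotp d d * chord_coord x ^+ 2.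
Definition chord_tube e : set pt := [set x | 0 <= chord_coord x <= 1 /\ chord_sqdist x <= e ^+ 2].

Let dotp_d_xi : dotp d xi = 1.
Proof. by rewrite dotpZr mulVf// gt_eqF// dotpp_gt0. Qed.

Lemma chord_coord_line s : chord_coord (a + s *: d) = s.
Proof. by rewrite /chord_coord dotpDl dotpZl dotp_d_xi mulr1 addrAC subrr add0r. Qed.

Lemma chord_sqdistE x : chord_sqdist x =
  dotp (x - (a + chord_coord x *: d)) (x - (a + chord_coord x *: d)).
Proof.
have dotp_d : dotp (x - a) d = dotp d d * chord_coord x.
  by rewrite /chord_coord -dotpBl dotpZr mulrA divff ?mul1r// gt_eqF// dotpp_gt0.
rewrite opprD addrA /chord_sqdist; move: (x - a) dotp_d => y dotp_d.
by rewrite !(dotpBl, dotpBr, dotpZl, dotpZr) (dotpC d) dotp_d; ring.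
Qed.

Lemma chord_sqdist_ge0 x : 0 <= chord_sqdist x.
Proof. by rewrite chord_sqdistE dotpp_ge0. Qed.

Lemma chord_sqdist_line s : chord_sqdist (a + s *: d) = 0.
Proof. by rewrite chord_sqdistE chord_coord_line subrr dotp0l. Qed.

Lemma chord_tube_near e x : 0 <= e -> chord_tube e x -> `|x - (a + chord_coord x *: d)| <= e.
Proof.
move=> e0 [_]; rewrite chord_sqdistE => xe.
by rewrite -(@ler_pXn2r _ 2)// ?nnegrE//; apply: le_trans (sqr_norm_le_dotpp _) xe.
Qed.

Lemma chord_tube_sub_ball (x0 : pt) (r e : R) : 0 <= e -> `|a - x0| < r - e ->
  `|a + d - x0| < r - e -> chord_tube e `<=` ball x0 r.
Proof.
move=> e0 ar br x tube_x; have [/andP[t0 t1] _] := tube_x; set t := chord_coord x in t0 t1.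
have t1' : 0 <= 1 - t by rewrite subr_ge0.
pose m := Num.max `|a - x0| `|a + d - x0|; have mr : m < r - e by rewrite gt_max ar br.
have [am bm] : `|a - x0| <= m /\ `|a + d - x0| <= m by split; rewrite le_max lexx ?orbT.
rewrite -ball_normE /= distrC -[x](subrK (a + t *: d)) -addrA.
apply: le_lt_trans (ler_normD _ _) _; have := chord_tube_near e0 tube_x.
have -> : a + t *: d - x0 = (1 - t) *: (a - x0) + t *: (a + d - x0).
  by apply/rowP => i; rewrite !mxE; ring.
have := ler_normD ((1 - t) *: (a - x0)) (t *: (a + d - x0)).
rewrite !normrZ !ger0_norm//; have := ler_wpM2l t1' am; have := ler_wpM2l t0 bm.
rewrite -/t; lra.
Qed.

Lemma is_hessian_chord_coord : is_hessian chord_coord (fun=> 0).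
Proof. exact: is_hessian_affine. Qed.

Lemma is_hessian_chord_sqdist :
  is_hessian chord_sqdist (fun=> 2%:M - (2 * dotp d d) *: (xi^T *m xi)).
Proof.
apply: eq_is_hessian (is_hessianD (is_hessian_sqdist a)
  (is_hessianZ (- dotp d d) (is_hessian_sqr_affine xi (- dotp a xi)))) => x.
  by rewrite mulNr.
by rewrite scalerA mulNr scaleNr (mulrC _ 2).
Qed.

(* The steep paraboloid around the chord, slightly concave along it. *)
Definition chord_test (c K : R) x : R :=
  c * (chord_coord x * (1 - chord_coord x)) + K * chord_sqdist x.

Definition chord_test_hessian (c K : R) : 'M[R]_N :=
  - (2 * c) *: (xi^T *m xi) + K *: (2%:M - (2 * dotp d d) *: (xi^T *m xi)).

Lemma is_hessian_chord_test c K : is_hessian (chord_test c K) (fun=> chord_test_hessian c K).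
Proof.
have := is_hessianD (is_hessianD (is_hessianZ c is_hessian_chord_coord)
  (is_hessianZ (- c) (is_hessian_sqr_affine xi (- dotp a xi))))
  (is_hessianZ K is_hessian_chord_sqdist).
apply: eq_is_hessian => x; rewrite ?scaler0 ?add0r.
  by rewrite /chord_test -/(chord_coord x); ring.
by rewrite scalerA mulNr (mulrC _ 2).
Qed.

Lemma qform_chord_test_hessian c K : qform (chord_test_hessian c K) d = - (2 * c).
Proof.
rewrite /chord_test_hessian -(scaleNr (2 * dotp d d)) !(qformD, qformZ) qform_scalar.
by rewrite !qform_outer dotp_d_xi; ring.
Qed.

Lemma compact_chord_tube e : 0 < e -> compact (chord_tube e).
Proof.
move=> e0; apply: bounded_closed_compact.
  exists (e + (`|a| + `|d|)); split=> [|M eM x ex]; first exact: num_real.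
  apply: le_trans (ltW eM); rewrite -[x](subrK (a + chord_coord x *: d)).
  apply: le_trans (ler_normD _ _) (lerD (chord_tube_near (ltW e0) ex) _).
  apply: le_trans (ler_normD _ _) _; rewrite lerD2l normrZ ler_piMl//.
  by case: ex => /andP[t0 t1] _; rewrite ger0_norm.
rewrite (_ : chord_tube e =
    chord_coord @^-1` `[0, 1] `&` chord_sqdist @^-1` [set y | y <= e ^+ 2]).
  apply: closedI; apply: preimage_closed => [x _|].
  - exact: is_hessian_continuous is_hessian_chord_coord x.
  - exact: itv_closed.
  - exact: is_hessian_continuous is_hessian_chord_sqdist x.
  - exact: closed_le.
by apply/seteqP; split=> x; rewrite /chord_tube /preimage /= in_itv/=.
Qed.

Lemma near_chord_tube e x : 0 < chord_coord x < 1 -> chord_sqdist x < e ^+ 2 ->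
  \forall y \near x, chord_tube e y.
Proof.
move=> /andP[t0 t1] qe; have ct := is_hessian_continuous is_hessian_chord_coord (x := x).
have cq := is_hessian_continuous is_hessian_chord_sqdist (x := x).
near=> y; split; last by apply: ltW; near: y; exact: cvgr_lt cq _ qe.
apply/andP; split; apply: ltW; near: y; [exact: cvgr_gt ct _ t0|exact: cvgr_lt ct _ t1].
Unshelve. all: by end_near. Qed.

Lemma chord_tube_test_point (u : pt -> R) (e lam c : R) : 0 < e -> usc_on (chord_tube e) u ->
  0 <= lam <= 1 -> 0 < c <= u (a + lam *: d) ->
  (forall x, `|a - x| <= e -> u x < c / 4) ->
  (forall x, `|a + d - x| <= e -> u x < c / 4) ->
  exists x K, chord_tube e x /\
    \forall y \near x, u y - chord_test c K y <= u x - chord_test c K x.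
Proof.
move=> e0 uu lam01 /andP[c0 cu] ua ub; have e2 : 0 < e ^+ 2 by rewrite exprn_gt0.
have tube_c : chord_tube e (a + lam *: d).
  by split; rewrite ?chord_coord_line// chord_sqdist_line sqr_ge0.
have tube0 : chord_tube e !=set0 by exists (a + lam *: d).
have [xb _ xbmax] := usc_on_max (compact_chord_tube e0) tube0 uu.
have cub : u (a + lam *: d) <= u xb by exact: xbmax.
pose K := (u xb + 1) / e ^+ 2; have K0 : 0 < K by rewrite divr_gt0//; lra.
have KE : K * e ^+ 2 = u xb + 1 by rewrite divfK// gt_eqF.
have utest : usc_on (chord_tube e) (fun x => u x - chord_test c K x).
  apply: usc_onD => //; apply/continuous_usc_on => x.
  exact/continuousN/(is_hessian_continuous (is_hessian_chord_test c K)).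
have [x tube_x xmax] := usc_on_max (compact_chord_tube e0) tube0 utest.
have ux : 3 / 4 * c + K * chord_sqdist x <= u x.
  have := xmax _ tube_c; rewrite /chord_test chord_coord_line chord_sqdist_line mulr0 addr0.
  case: tube_x => /andP[t0 t1] _; have t1' : 0 <= 1 - chord_coord x by rewrite subr_ge0.
  have := mulr_ge0 (ltW c0) (mulr_ge0 t0 t1').
  by have := mulr_ge0 (ltW c0) (sqr_ge0 (lam - 1 / 2)); lra.
have near_axis := chord_tube_near (ltW e0) tube_x.
have Kq := mulr_ge0 (ltW K0) (chord_sqdist_ge0 x).
exists x, K; split=> //; have [/andP[t0 t1] qe] := tube_x.
apply: (filterS xmax); apply: near_chord_tube.
- rewrite !lt_neqAle t0 t1 !andbT; apply/andP; split; apply/eqP => tE; move: near_axis.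
    by rewrite -tE scale0r addr0 distrC => /ua; lra.
  by rewrite tE scale1r distrC => /ub; lra.
- rewrite lt_neqAle qe andbT; apply/eqP => qE; move: ux; rewrite qE KE.
  by have := xbmax x tube_x; lra.
Qed.

End ChordTube.

Lemma convex_functionP (R : realType) (V : lmodType R) (D : set V) (f : V -> R) :
  @convex_function R V D f <-> forall (x y : V) (t : R), D x -> D y -> 0 <= t <= 1 ->
    f (x + t *: (y - x)) <= f x + t * (f y - f x).
Proof.
have combE (x y : V) (t : R) : x + t *: (y - x) = t *: y + (1 - t) *: x.
  by rewrite scalerBr scalerBl scale1r addrCA.
have combRE (x y t : R) : x + t * (y - x) = t * y + (1 - t) * x by ring.
split=> [cvx x y t Dx Dy /andP[t0 t1]|cvx t y x].
  by have := cvx (Itv01 t0 t1) y x; rewrite !inE combE combRE; exact.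
rewrite !inE => Dy Dx; have := cvx x y t%:num Dx Dy; rewrite combE combRE; apply.
by rewrite ge0/=.
Qed.

Section ViscosityConvexity.
Variables (R : realType) (N : nat).
Notation pt := 'rV[R]_N.
Implicit Types (u : pt -> R) (x a b d : pt).

Lemma visc_psd_chord_le0 u (x0 : pt) (r : R) a d (lam : R) : 0 < r ->
  usc_on (closed_ball x0 r) u -> visc_hessian_in (@psd R N) (ball x0 r) u ->
  `|a - x0| < r -> `|a + d - x0| < r -> 0 <= lam <= 1 ->
  u a <= 0 -> u (a + d) <= 0 -> u (a + lam *: d) <= 0.
Proof.
move=> r0 uu upsd ar br lam01 ua ub; have [->|d0] := eqVneq d 0; first by rewrite scaler0 addr0.
rewrite leNgt; apply/negP => c0; set c := u _ in c0.
have near_lt x : `|x - x0| < r -> u x <= 0 ->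
    \forall e \near 0^'+, forall y, `|x - y| <= e -> u y < c / 4.
  move=> xr ux; apply/nbhsr0P; have c4 : 0 < c / 4 by rewrite divr_gt0.
  have cball_x : closed_ball x0 r x by apply/closed_ballP => //; exact: ltW.
  have := (usc_onP _ _).1 uu x cball_x _ c4.
  by apply: filterS2 (near_closed_ball xr) => y yr /(_ yr); lra.
have [e [e0 tube_ball near_a near_b]] : exists e, [/\ 0 < e,
    chord_tube a d e `<=` ball x0 r, forall y, `|a - y| <= e -> u y < c / 4 &
    forall y, `|a + d - y| <= e -> u y < c / 4].
  apply: (@filter_ex _ 0^'+); near=> e; have e0 : 0 < e by [].
  split=> //; [|by near: e; exact: near_lt|by near: e; exact: near_lt].
  apply: chord_tube_sub_ball (ltW e0) _ _ => //; rewrite ltrBrDl -ltrBrDr;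
    by near: e; apply: nbhs_right_lt; rewrite subr_gt0.
have tube_cball : chord_tube a d e `<=` closed_ball x0 r.
  by move=> x /tube_ball; exact: subset_closed_ball.
have [|x [K [/tube_ball xr xmax]]] := chord_tube_test_point d0 e0 (usc_onS tube_cball uu)
  lam01 _ near_a near_b; first by rewrite c0 lexx.
have /psdP/(_ d) := upsd _ _ _ (is_hessian_chord_test a d c K) xr xmax.
by rewrite qform_chord_test_hessian// -/c; lra.
Unshelve. all: by end_near. Qed.

Lemma visc_psd_convex u (x0 : pt) (r : R) : 0 < r -> usc_on (closed_ball x0 r) u ->
  visc_hessian_in (@psd R N) (ball x0 r) u -> @convex_function R pt (ball x0 r) u.
Proof.
move=> r0 uu upsd; apply/convex_functionP => a b lam.
rewrite -!ball_normE /= !(distrC x0) => ar br lam01; pose d := b - a.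
have [d0|d0] := eqVneq d 0.
  by move/eqP: (d0); rewrite /d subr_eq0 => /eqP ->; rewrite !subrr scaler0 mulr0 !addr0.
have bE : a + d = b by rewrite /d addrC subrK.
pose l x : R := u a + (u b - u a) * chord_coord a d x.
have lH : is_hessian l (fun=> 0).
  have := is_hessian_addr (u a) (is_hessianZ (u b - u a) (is_hessian_chord_coord a d)).
  by apply: eq_is_hessian => x; rewrite ?scaler0// addrC.
have lE s : l (a + s *: d) = u a + s * (u b - u a) by rewrite /l chord_coord_line// mulrC.
have la : l a = u a by have := lE 0; rewrite scale0r addr0 mul0r addr0.
have lb : l (a + d) = u b by have := lE 1; rewrite scale1r mul1r (addrC (u a)) subrK.
rewrite -lE -subr_le0; apply: (@visc_psd_chord_le0 (fun x => u x - l x) x0 r a d lam) => //.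
- apply: usc_onD => //; apply/continuous_usc_on => x.
  exact/continuousN/(is_hessian_continuous lH).
- apply: visc_hessian_inW (visc_hessian_in_is_hessian lH upsd) => // A [x _].
  by rewrite addr0.
- by rewrite bE.
- by rewrite la subrr.
- by rewrite lb bE subrr.
Qed.

End ViscosityConvexity.

Section LipschitzConvex.
Variables (R : realType) (V : normedModType R).
Implicit Types (f : V -> R) (x y : V).

Lemma convex_ball_ge f (x0 x : V) (r A : R) : @convex_function R V (ball x0 r) f ->
  (forall y, `|y - x0| < r -> f y <= A) -> `|x - x0| < r -> 2 * f x0 - A <= f x.
Proof.
move=> /convex_functionP cvx fA xr; pose x' := x0 + (x0 - x).
have x'r : `|x' - x0| < r by rewrite addrAC subrr add0r distrC.
have half : 0 <= (1 / 2 : R) <= 1 by lra.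
have := cvx x x' _ _ _ half; rewrite -ball_normE /= !(distrC x0) => /(_ xr x'r).
have -> : x + (1 / 2) *: (x' - x) = x0.
  have -> : x' - x = 2 *: (x0 - x) by rewrite /x' addrAC scaler_nat mulr2n.
  by rewrite scalerA div1r mulVf// scale1r addrC subrK.
by have := fA _ x'r; lra.
Qed.

(* Extend the segment from [x] to [y] by [r / 4] and compare the slopes. *)
Lemma convex_ball_slope_le f (x0 x y : V) (r B : R) : 0 < r -> 0 <= B ->
  @convex_function R V (ball x0 r) f ->
  (forall z, `|z - x0| < r -> f z - f x <= B) -> `|x - x0| < r -> `|y - x0| <= r / 2 ->
  f y - f x <= 4 * B / r * `|x - y|.
Proof.
move=> r0 B0 /convex_functionP cvx fB xr yr.
have [->|yx] := eqVneq y x; first by rewrite !subrr normr0 mulr0.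
pose e := `|x - y|; have e0 : 0 < e by rewrite normr_gt0 subr_eq0 eq_sym.
have er0 : 0 < e + r / 4 by rewrite addr_gt0// divr_gt0.
pose z := x + ((e + r / 4) / e) *: (y - x); pose lam := e / (e + r / 4).
have zr : `|z - x0| < r.
  have -> : z - x0 = (y - x0) + (r / 4 / e) *: (y - x).
    rewrite /z mulrDl divff ?gt_eqF// scalerDl scale1r.
    by rewrite addrCA addrA subrK addrAC.
  rewrite (le_lt_trans (ler_normD _ _))// normrZ (distrC y x) -/e.
  by rewrite [`|_ / e|]ger0_norm ?divr_ge0 ?(ltW e0) ?(ltW r0)// divfK ?gt_eqF//; lra.
have lam01 : 0 <= lam <= 1.
  rewrite divr_ge0 ?(ltW e0) ?(ltW er0)//= ler_pdivrMr// mul1r lerDl.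
  by rewrite divr_ge0// ltW.
have := cvx x z _ _ _ lam01; rewrite -ball_normE /= !(distrC x0) => /(_ xr zr).
have -> : x + lam *: (z - x) = y.
  rewrite /z addrAC subrr add0r scalerA /lam mulrA divfK ?(gt_eqF er0)// divff ?gt_eqF//.
  by rewrite scale1r addrC subrK.
have : lam * (f z - f x) <= lam * B by apply: ler_wpM2l (fB z zr); case/andP: lam01.
have lam_le : lam <= 4 / r * e.
  rewrite /lam ler_pdivrMr// (_ : 4 / r * e * (e + r / 4) = e + 4 / r * e ^+ 2).
    by rewrite lerDl mulr_ge0 ?sqr_ge0// divr_ge0// ltW.
  by field; rewrite gt_eqF.
by have := ler_wpM2r B0 lam_le; rewrite -/e; lra.
Qed.

Lemma convex_ball_lipschitz f (x0 : V) (r A : R) : 0 < r -> @convex_function R V (ball x0 r) f ->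
  (forall x, `|x - x0| < r -> f x <= A) ->
  (8 * (A - f x0) / r).-lipschitz_(closed_ball x0 (r / 2)) f.
Proof.
move=> r0 cvx fA; have r2 : 0 < r / 2 by rewrite divr_gt0.
have A0 : f x0 <= A by apply: fA; rewrite subrr normr0.
have B0 : 0 <= 2 * (A - f x0) by lra.
have slope x y : `|x - x0| <= r / 2 -> `|y - x0| <= r / 2 ->
    f y - f x <= 8 * (A - f x0) / r * `|x - y|.
  move=> xr; have {}xr : `|x - x0| < r by lra.
  rewrite (_ : 8 * _ / r = 4 * (2 * (A - f x0)) / r); last by ring.
  apply: convex_ball_slope_le => // z zr.
  by have := convex_ball_ge cvx fA xr; have := fA z zr; lra.
move=> [x y] /= [/(closed_ballP _ _ r2) xr /(closed_ballP _ _ r2) yr].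
by rewrite ler_norml; have := slope x y xr yr; have := slope y x yr xr; rewrite distrC; lra.
Qed.

End LipschitzConvex.

Section LipschitzExtension.
Variables (R : realType) (N : nat).
Notation pt := 'rV[R]_N.
Implicit Types (x y : pt).

Definition clamp (x0 : pt) (r : R) x : pt :=
  \row_i Num.max (x0 0 i - r) (Num.min (x0 0 i + r) (x 0 i)).

Lemma clamp_in (x0 : pt) (r : R) x : 0 <= r -> `|clamp x0 r x - x0| <= r.
Proof.
move=> r0; apply: rV_norm_le => // i; rewrite !mxE ler_distl le_max lexx/= ge_max.
by rewrite ge_min lexx/= andbT; lra.
Qed.

Lemma clamp_id (x0 : pt) (r : R) x : `|x - x0| <= r -> clamp x0 r x = x.
Proof.
move=> xr; apply/rowP => i; rewrite mxE.
have := coord_le_norm (x - x0) i; rewrite !mxE => /le_trans/(_ xr).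
by rewrite ler_distl => /andP[lo hi]; rewrite (min_idPr hi) (max_idPr lo).
Qed.

Lemma clamp_dist_le (x0 : pt) (r : R) x y : `|clamp x0 r x - clamp x0 r y| <= `|x - y|.
Proof.
apply: rV_norm_le => // i; apply: le_trans (coord_le_norm (x - y) i); rewrite !mxE.
move: (x 0 i) (y 0 i) => s t; wlog st : s t / s <= t => [W|].
  by have [/W//|/ltW/W] := leP s t; rewrite distrC (distrC t).
rewrite distrC (distrC s) [leRHS]ger0_norm ?subr_ge0//.
set lo := x0 0 i - r; set hi := x0 0 i + r.
have [min_le min_dist] : Num.min hi s <= Num.min hi t /\ Num.min hi t - Num.min hi s <= t - s.
  by case: (leP hi s) => ?; case: (leP hi t) => ?; lra.
move: (Num.min hi s) (Num.min hi t) min_le min_dist => p q pq qp.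
by rewrite ler_norml; case: (leP lo p) => ?; case: (leP lo q) => ?; lra.
Qed.

Lemma lipschitz_bounded_extension (u : pt -> R) (x0 : pt) (r L : R) : 0 < r -> 0 <= L ->
  L.-lipschitz_(closed_ball x0 r) u ->
  exists g M, [/\ L.-lipschitz g, forall x, `|g x| <= M & forall x, `|x - x0| <= r -> g x = u x].
Proof.
move=> r0 L0 uL; have in_ball x : closed_ball x0 r (clamp x0 r x).
  by apply/closed_ballP => //; apply: clamp_in; exact: ltW.
have lip x y : `|u (clamp x0 r x) - u (clamp x0 r y)| <= L * `|clamp x0 r x - clamp x0 r y|.
  by apply: (uL (clamp x0 r x, clamp x0 r y)); split; exact: in_ball.
exists (fun x => u (clamp x0 r x)), (`|u x0| + L * r); split=> [|x|x /clamp_id->//].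
  apply/klipschitzP => x y; apply: le_trans (lip x y) _.
  by rewrite ler_wpM2l// clamp_dist_le.
rewrite -[u _](subrK (u x0)) addrC (le_trans (ler_normD _ _))// lerD2l.
have clamp_x0 : clamp x0 r x0 = x0 by rewrite clamp_id// subrr normr0 ltW.
rewrite -{2}clamp_x0; apply: le_trans (lip x x0) _.
by rewrite ler_wpM2l// clamp_x0 clamp_in// ltW.
Qed.

End LipschitzExtension.

Section Subsolutions.
Variables (R : realType) (N : nat).
Notation pt := 'rV[R]_N.
Variables (Omega : set pt) (h u : pt -> R).
Hypothesis usub : Q_subsolution Omega h u.
Hypothesis uusc : usc_on (closure Omega) u.
Implicit Types (x : pt) (r : R).

Lemma Q_subsolution_test phi H x : Omega x -> is_hessian phi H ->
  (\forall y \near x, u y - phi y <= u x - phi x) -> ThetaMA h x (u x, H x).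
Proof.
move=> Ox phiH umax; have phicH := is_hessian_addr (u x - phi x) phiH.
have [|h_le Qp] := usub Ox (p := (u x, H x)); last by split=> //; rewrite -subr_ge0.
exists (fun y => phi y + (u x - phi x)); split.
- exact: is_hessian_C2_near phicH.
- have /nbhs_ballP[r /= r0 ur] := umax; exists r => // y _ /ur; lra.
- by rewrite addrC subrK.
- by rewrite (hessianE x phicH) addrC subrK.
Qed.

Lemma closed_ball_usc_on (x0 : pt) r : closed_ball x0 r `<=` Omega -> usc_on (closed_ball x0 r) u.
Proof. by move=> BO; apply: usc_onS uusc; exact: subset_trans BO (@subset_closure _ _). Qed.

Lemma Q_subsolution_le0 (x0 : pt) r : 0 < r -> closed_ball x0 r `<=` Omega -> u x0 <= 0.
Proof.
move=> r0 BO; have [x [K [xr ux umax]]] := usc_on_penalized_max r0 (closed_ball_usc_on BO).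
have Ox : Omega x by apply/BO/closed_ballP => //; exact: ltW.
have [[_ [/= u0 _]] _] := Q_subsolution_test Ox (is_hessianZ K (is_hessian_sqdist x0)) umax.
exact: le_trans ux u0.
Qed.

Lemma Q_subsolution_lipschitz (x0 : pt) r : 0 < r -> closed_ball x0 r `<=` Omega ->
  exists g L M, [/\ 0 <= L, L.-lipschitz g, forall x, `|g x| <= M &
    forall x, `|x - x0| <= r / 2 -> g x = u x].
Proof.
move=> r0 BO.
have u_le0 x : `|x - x0| < r -> u x <= 0.
  move=> xr; apply: (@Q_subsolution_le0 x (r - `|x - x0|)); first by rewrite subr_gt0.
  apply: subset_trans BO => y; rewrite !closed_ballE ?subr_gt0// /closed_ball_ /= => xy.
  by have := ler_distD x x0 y; rewrite (distrC x0 x); lra.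
have u_psd : visc_hessian_in (@psd R N) (ball x0 r) u.
  move=> phi H x phiH /subset_closed_ball/BO Ox umax.
  by have [[_ [_ pH]] _] := Q_subsolution_test Ox phiH umax.
have cvx := visc_psd_convex r0 (closed_ball_usc_on BO) u_psd.
have lip := convex_ball_lipschitz r0 cvx u_le0.
have u0 : u x0 <= 0 by apply: u_le0; rewrite subrr normr0.
have L0 : 0 <= 8 * (0 - u x0) / r by rewrite divr_ge0 ?(ltW r0)//; lra.
have r2 : 0 < r / 2 by rewrite divr_gt0.
have [g [M [gL gM gu]]] := lipschitz_bounded_extension r2 L0 lip.
by exists g, (8 * (0 - u x0) / r), M.
Qed.

End Subsolutions.

(** * Comparison *)

Lemma MA_addscalar_ge (R : realType) (N : nat) (A : 'M[R]_N) (s t c q : R) :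
  (0 < N)%N -> 0 < c -> c <= - s -> 0 <= t ->
  det_superlevel (q / c ^+ (N + 2)) A -> q + c ^+ (N + 2) * t ^+ N <= MA (s, A + t%:M).
Proof.
move=> N0 c0 cs t0 [sA pA qA]; have cN0 : 0 < c ^+ (N + 2) by rewrite exprn_gt0.
have := psd_det_superadd N0 sA (symmx_scalar N t) pA (psd_scalar t0).
rewrite det_scalar => detD; have pD := psdD pA (psd_scalar t0).
have sD := symmxD sA (symmx_scalar N t).
apply: (@le_trans _ _ (c ^+ (N + 2) * \det (A + t%:M))).
  apply: le_trans (ler_wpM2l (ltW cN0) detD).
  by rewrite mulrDr lerD2r mulrC -ler_pdivrMr.
by rewrite /MA ler_wpM2r ?psd_det_ge0// lerXn2r ?nnegrE ?(ltW c0)// (le_trans (ltW c0)).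
Qed.

Section Contact.
Variables (R : realType) (N : nat).
Hypothesis N0 : (0 < N)%N.
Notation pt := 'rV[R]_N.
Variables (Omega : set pt) (h u v : pt -> R).
Hypothesis oO : open Omega.
Hypothesis ch : {within Omega, continuous h}.
Hypotheses (usub : Q_subsolution Omega h u) (vsup : Q_supersolution Omega h v).
Hypotheses (uusc : usc_on (closure Omega) u) (vlsc : lsc_on (closure Omega) v).
Implicit Types (x y : pt) (A : 'M[R]_N).

Lemma open_Q_subsolution_le0 x : Omega x -> u x <= 0.
Proof.
move=> Ox; have /nbhs_closedballP[e] := open_nbhs_nbhs (conj oO Ox).
exact: (Q_subsolution_le0 usub uusc).
Qed.

Lemma Q_subsolution_continuous_at x : Omega x -> {for x, continuous u}.
Proof.
move=> Ox; have /nbhs_closedballP[e BO] := open_nbhs_nbhs (conj oO Ox).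
have [|g [L [M [_ gL _ gu]]]] := Q_subsolution_lipschitz usub uusc _ BO; first by [].
have ug : {near x, g =1 u}.
  have e2 : 0 < e%:num / 2 by [].
  by apply: filterS (nbhsx_ballx x _ e2) => y /subset_closed_ball/(closed_ballP _ _ e2)/gu.
apply: cvg_trans (near_eq_cvg ug) _; rewrite -(nbhs_singleton ug).
exact: klipschitz_continuous gL x.
Qed.

Lemma Q_subsolution_smooth_approx (x0 : pt) (r c q eta : R) : 0 < r -> 0 < c -> 0 < eta ->
  closed_ball x0 (4 * r) `<=` Omega ->
  (forall x, `|x - x0| < 2 * r -> - c <= u x /\ q <= h x) ->
  exists f H, [/\ is_hessian f H, forall x, `|x - x0| <= r -> `|f x - u x| <= eta &
    forall x, `|x - x0| <= r -> det_superlevel (q / c ^+ (N + 2)) (H x)].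
Proof.
move=> r0 c0 eta0 BO uhge; have r2 : 0 < 2 * r by rewrite mulr_gt0.
have [|g [L [M [L0 gL gM]]]] := Q_subsolution_lipschitz usub uusc _ BO.
  by rewrite mulr_gt0.
have -> : 4 * r / 2 = 2 * r by field.
move=> gu; have gH : visc_hessian_in (@det_superlevel R N (q / c ^+ (N + 2))) (ball x0 (2 * r)) g.
  apply: (@visc_hessian_in_eq _ _ _ _ u); first exact: ball_open.
    by move=> x; rewrite -ball_normE/= distrC => /ltW/gu.
  move=> phi H x phiH; rewrite -ball_normE/= distrC => xr umax.
  have Ox : Omega x.
    by apply: BO; apply/closed_ballP; [rewrite mulr_gt0|lra].
  have [[/= sH [/= ux pH]] hle] := Q_subsolution_test usub Ox phiH umax.
  have [cu qh] := uhge x xr; split=> //.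
  rewrite ler_pdivrMr ?exprn_gt0// mulrC (le_trans (le_trans qh hle))//.
  by rewrite ler_wpM2r ?psd_det_ge0// lerXn2r ?nnegrE ?oppr_ge0 ?(ltW c0)// lerNl.
have [f [H [fH fg HP]]] := det_superlevel_smooth_approx N0 r2 L0 eta0 gM gL gH.
exists f, H; split=> // x xr; first by rewrite -gu//; lra.
by apply: HP; rewrite mulrAC divff// mul1r.
Qed.

Lemma Q_supersolution_test phi H y : Omega y -> is_hessian phi H ->
  (\forall x \near y, phi x - v x <= phi y - v y) -> rinterior (@Qset R N) (v y, H y) ->
  MA (v y, H y) <= h y.
Proof.
move=> Oy phiH ymax Qint; have phicH := is_hessian_addr (v y - phi y) phiH.
have [|| //] := vsup Oy (p := (v y, H y)); last by rewrite subr_le0.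
exists (fun x => phi x + (v y - phi y)); split.
- exact: is_hessian_C2_near phicH.
- have /nbhs_ballP[r /= r0 vr] := ymax; exists r => // x _ /vr; lra.
- by rewrite addrC subrK.
- by rewrite (hessianE y phicH) addrC subrK.
Qed.

(* Half of the convexity of [del |x|^2] is spent on localizing the maximum at [x0]. *)
Lemma is_hessian_localized f H (x0 : pt) (del : R) : is_hessian f H ->
  is_hessian (fun x => f x + (del * dotp x x - del / 2 * dotp (x - x0) (x - x0)))
             (fun x => H x + del%:M).
Proof.
move=> fH; have := is_hessianD (is_hessianZ del (is_hessian_sqdist (0 : pt)))
  (is_hessianZ (- (del / 2)) (is_hessian_sqdist x0)).
move/(is_hessianD fH); apply: eq_is_hessian => x; first by rewrite subr0 mulNr.
by rewrite -scalerDl scale_scalar_mx; congr (_ + _%:M); field.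
Qed.

Lemma contact_in_ball (x0 : pt) (r del c q : R) : 0 < r -> 0 < del -> 0 < c -> c < - v x0 ->
  closed_ball x0 (4 * r) `<=` Omega ->
  (forall x, `|x - x0| < 2 * r -> - c <= u x /\ q <= h x) ->
  (forall x, `|x - x0| <= r -> u x - v x + del * dotp x x <= u x0 - v x0 + del * dotp x0 x0) ->
  (forall x, `|x - x0| <= r ->
     u x + del * dotp x x <= u x0 + del * dotp x0 x0 + (- v x0 - c) / 2) ->
  exists y A, [/\ `|y - x0| <= r, c <= - v y, det_superlevel (q / c ^+ (N + 2)) A &
    MA (v y, A + del%:M) <= h y].
Proof.
move=> r0 del0 c0 cv BO uhge wmax u_le; pose eta := Num.min ((- v x0 - c) / 4) (del * r ^+ 2 / 8).
have [eta_gap eta_r] : eta <= (- v x0 - c) / 4 /\ eta <= del * r ^+ 2 / 8.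
  by split; rewrite ge_min lexx ?orbT.
have delr0 : 0 < del * r ^+ 2 by rewrite mulr_gt0 ?exprn_gt0.
have eta0 : 0 < eta by rewrite lt_min; apply/andP; lra.
have [f [H [fH fu HP]]] := Q_subsolution_smooth_approx r0 c0 eta0 BO uhge.
have {}fu x : `|x - x0| <= r -> u x - eta <= f x <= u x + eta by rewrite -ler_distl => /fu.
pose phi x := f x + (del * dotp x x - del / 2 * dotp (x - x0) (x - x0)).
have phiH : is_hessian phi (fun x => H x + del%:M) := is_hessian_localized x0 del fH.
have phi0 : u x0 - eta + del * dotp x0 x0 <= phi x0.
  have := fu x0; rewrite /phi subrr normr0 dotp0l mulr0 subr0 lerD2r.
  by move=> /(_ (ltW r0))/andP[].
have phi_le x : `|x - x0| <= r ->
    phi x <= u x + eta + del * dotp x x - del / 2 * dotp (x - x0) (x - x0).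
  by move=> /fu/andP[_]; rewrite /phi; lra.
have BrO : closed_ball x0 r `<=` Omega.
  by apply: subset_trans BO; apply: le_closed_ball; lra.
have uphi : usc_on (closed_ball x0 r) (fun x => phi x - v x).
  apply: usc_onD; first exact/continuous_usc_on/(is_hessian_continuous phiH).
  apply: usc_onS (subset_trans BrO (@subset_closure _ _)) _; exact/lsc_on_usc_onN.
have [y [yr ymin ymax]] : exists y, [/\ `|y - x0| < r, phi x0 - v x0 <= phi y - v y &
    \forall x \near y, phi x - v x <= phi y - v y].
  apply: usc_on_interior_max uphi _ => // x xr.
  have : del / 2 * r ^+ 2 <= del / 2 * dotp (x - x0) (x - x0).
    by rewrite ler_pM2l ?divr_gt0// -xr sqr_norm_le_dotpp.
  by have := phi_le x; have := wmax x; rewrite xr lexx => /(_ isT) ? /(_ isT); lra.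
have cy : c <= - v y.
  have : 0 <= del / 2 * dotp (y - x0) (y - x0) by rewrite mulr_ge0 ?dotpp_ge0// ltW ?divr_gt0.
  by have := phi_le y (ltW yr); have := u_le y (ltW yr); lra.
have Oy : Omega y by apply/BrO/closed_ballP => //; exact: ltW.
have [sH pH detH] := HP y (ltW yr); exists y, (H y); split=> //; first exact: ltW.
apply: (Q_supersolution_test Oy phiH ymax); apply: rinterior_Qset => //.
by rewrite -oppr_gt0 (lt_le_trans c0).
Qed.

Lemma contact_point (x0 : pt) (del c tau : R) : Omega x0 -> 0 < del -> 0 < tau ->
  - u x0 < c -> c < - v x0 ->
  (\forall x \near x0,
     u x - v x + del * dotp x x <= u x0 - v x0 + del * dotp x0 x0) ->
  exists y A, [/\ h y <= h x0 + tau, c <= - v y,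
    det_superlevel ((h x0 - tau) / c ^+ (N + 2)) A & MA (v y, A + del%:M) <= h y].
Proof.
move=> Ox0 del0 tau0 uc cv wmax; have cu := Q_subsolution_continuous_at Ox0.
have c0 : 0 < c by rewrite (le_lt_trans _ uc)// oppr_ge0 open_Q_subsolution_le0.
have ch0 := within_open_continuous_at oO ch Ox0.
have cw : {for x0, continuous (fun x : pt => u x + del * dotp x x)}.
  exact: (cvgD cu (cvgM (cvg_cst _) (@continuous_dotpp _ _ x0))).
have u_ge : \forall x \near x0, - c <= u x by apply: (cvgr_ge _ cu); rewrite ltrNl.
have w_le : \forall x \near x0,
    u x + del * dotp x x <= u x0 + del * dotp x0 x0 + (- v x0 - c) / 2.
  by apply: (cvgr_le _ cw); rewrite ltrDl divr_gt0// subr_gt0.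
have h_ge : \forall x \near x0, h x0 - tau <= h x.
  by apply: (cvgr_ge _ ch0); rewrite ltrBlDr ltrDl.
have h_le : \forall x \near x0, h x <= h x0 + tau.
  by apply: (cvgr_le _ ch0); rewrite ltrDl.
have [e near_x0] := (nbhs_closedballP _ _).1 (filterI (filterI (open_nbhs_nbhs (conj oO Ox0))
  (filterI u_ge h_ge)) (filterI h_le (filterI w_le wmax))).
have r0 : 0 < e%:num / 4 by [].
have in_ball x : `|x - x0| <= e%:num -> closed_ball x0 e%:num x by move/closed_ballP; apply.
have [|x xr|x xr|x xr|y [A [yr cy AP MAy]]] := contact_in_ball r0 del0 c0 cv (q := h x0 - tau).
- by rewrite mulrC divfK// => x /near_x0[[]].
- by have [|[_ []]] := near_x0 x; first by apply: in_ball; lra.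
- by have [|_ [_ []]] := near_x0 x; first by apply: in_ball; lra.
- by have [|_ [_ []]] := near_x0 x; first by apply: in_ball; lra.
- exists y, A; split=> //.
  by have [|_ []] := near_x0 y; first by apply: in_ball; lra.
Qed.

Lemma Q_subsolution_le_supersolution_at_max (x0 : pt) (del : R) : Omega x0 -> 0 < del ->
  (\forall x \near x0, u x - v x + del * dotp x x <= u x0 - v x0 + del * dotp x0 x0) ->
  u x0 <= v x0.
Proof.
move=> Ox0 del0 wmax; rewrite leNgt; apply/negP => vu.
have u0 := open_Q_subsolution_le0 Ox0.
pose c := - (u x0 + v x0) / 2; pose gain := c ^+ (N + 2) * del ^+ N.
have [uc cv c0] : [/\ - u x0 < c, c < - v x0 & 0 < c] by rewrite /c; split; lra.
have gain0 : 0 < gain by rewrite mulr_gt0 ?exprn_gt0.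
have tau0 : 0 < gain / 3 by rewrite divr_gt0.
have [y [A [hy cy AP]]] := contact_point Ox0 del0 tau0 uc cv wmax.
have := MA_addscalar_ge N0 c0 cy (ltW del0) AP; rewrite -/gain; lra.
Qed.

End Contact.

Theorem comparison (R : realType) (N : nat) (Omega : set 'rV[R]_N) (h u v : 'rV[R]_N -> R) :
  (0 < N)%N -> open Omega -> bounded_set Omega -> {within Omega, continuous h} ->
  usc_on (closure Omega) u -> lsc_on (closure Omega) v ->
  Q_subsolution Omega h u -> Q_supersolution Omega h v ->
  (forall x, (closure Omega `\` Omega) x -> u x <= v x) ->
  forall x, Omega x -> u x <= v x.
Proof.
move=> N0 oO bO ch uusc vlsc usub vsup uv x1 Ox1; rewrite leNgt; apply/negP => vu1.
have cO := compact_closure_bounded bO.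
have O1 : closure Omega x1 by exact: subset_closure.
have O0 : closure Omega !=set0 by exists x1.
have csq D : usc_on D (fun x : 'rV[R]_N => dotp x x).
  exact/continuous_usc_on/continuous_dotpp.
have [xm _ sq_le] := usc_on_max cO O0 (csq _).
pose C := dotp xm xm + 1; have C0 : 0 < C by rewrite ltr_wpDl ?dotpp_ge0.
pose del := (u x1 - v x1) / C.
have del0 : 0 < del by rewrite divr_gt0// subr_gt0.
have delC : del * C = u x1 - v x1 by rewrite divfK// gt_eqF.
have uw : usc_on (closure Omega) (fun x => u x - v x + del * dotp x x).
  apply: usc_onD; first by apply: usc_onD => //; exact/lsc_on_usc_onN.
  exact/continuous_usc_on/continuous_cstM/continuous_dotpp.
have [x0 Ox0 wmax] := usc_on_max cO O0 uw.
have : u x0 <= v x0.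
  have [Oin|nO] := pselect (Omega x0); last exact: uv.
  apply: (Q_subsolution_le_supersolution_at_max N0 oO ch usub vsup uusc vlsc Oin del0).
  apply: filterS (open_nbhs_nbhs (conj oO Oin)) => x /subset_closure; exact: wmax.
have := wmax x1 O1; have := mulr_ge0 (ltW del0) (dotpp_ge0 x1).
have := ler_wpM2l (ltW del0) (sq_le _ Ox0); rewrite -delC /C; lra.
Qed.

Theorem theorem6p14 (R : realType) (N : nat) (hN : (0 < N)%N)
  (Omega : set 'rV[R]_N) (h : 'rV[R]_N -> R) :
  open Omega -> connected Omega -> bounded_set Omega ->
  {within Omega, continuous h} -> (forall x, Omega x -> 0 <= h x) ->
  (proper_elliptic Omega (ThetaMA h)
   /\ hausdorff_continuous Omega (ThetaMA h)
   /\ (forall x, Omega x ->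
         rboundary (ThetaMA h x) `<=`
         [set p | SymPairs p /\ (- p.1) ^+ (N + 2) * \det p.2 = h x]))
  /\
  (forall u v : 'rV[R]_N -> R,
     usc_on (closure Omega) u -> lsc_on (closure Omega) v ->
     Q_subsolution Omega h u -> Q_supersolution Omega h v ->
     (forall x, (closure Omega `\` Omega) x -> u x <= v x) ->
     forall x, Omega x -> u x <= v x).
Proof.
move=> oO _ bO ch h0; split; last by move=> u v *; exact: (comparison hN oO bO ch (u := u)).
split; first exact: ThetaMA_proper_elliptic.
split; first exact: ThetaMA_hausdorff_continuous.
by move=> x Ox; apply: ThetaMA_boundary => //; exact: h0.
Qed.
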